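(* Let $\sigma$ be a non-crossing partition of $\{\bar1,\dots,\bar n\}$ and $i\in[2n]$. If $i$ is a singleton block of $(\sigma|\tilde\sigma)$, then $\mathfrak u_i(w_\sigma)=0$; otherwise $\mathfrak u_i(w_\sigma)=w_{g_i\sigma}$. The same holds for the operators $\mathfrak u_i|_V$ acting on $\bigwedge^{n-1}V$.
   Context: Place $\bar 1,\dots,\bar n$ clockwise on a circle and $\tilde i$ on the arc between $\bar i$ and $\overline{i+1}$ ($\tilde n$ between $\bar n$ and $\bar1$). For a non-crossing partition $\sigma$ of $\{\bar 1,\dots,\bar n\}$, $\tilde\sigma$ is the coarsest partition of $\{\tilde1,\dots,\tilde n\}$ with $\sigma\cup\tilde\sigma$ non-crossing; $\sigma\mapsto\tilde\sigma$ is a bijection between non-crossing partitions of the bars and of the tildes. Identifying $\bar k\leftrightarrow 2k-1$, $\tilde k\leftrightarrow 2k$ gives a partition $(\sigma|\tilde\sigma)$ of $[2n]$. An $(n-1)$-subset $I\subset[2n]$ is concordant with $\sigma$ if each block of $\sigma$ and of $\tilde\sigma$ contains exactly one element of $[2n]\setminus I$; $w_\sigma=\sum_{I\text{ concordant}}e_I\in\bigwedge^{n-1}\mathbb R^{2n}$, $e_I=e_{i_1}\wedge\dots\wedge e_{i_{n-1}}$ ($i_1<\dots<i_{n-1}$), $e_k$ the standard (row) basis vectors. Isolation: if $i=2k-1$ and $\bar k$ is not a singleton in $\sigma$, $g_i\sigma$ is obtained from $\sigma$ by removing $\bar k$ from its block and making it a singleton; if $i=2k$ and $\tilde k$ is not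 a singleton in $\tilde\sigma$, $g_i\sigma$ is the unique non-crossing partition of the bars whose dual is obtained from $\tilde\sigma$ by making $\tilde k$ a singleton. Lam generators: with $E_{a,b}$ the matrix units in $2n\times 2n$ matrices, $\mathfrak u_i=E_{i,i+1}+E_{i,i-1}$ for $2\le i\le 2n-1$, $\mathfrak u_1=E_{1,2}+(-1)^nE_{1,2n}$, $\mathfrak u_{2n}=E_{2n,2n-1}+(-1)^nE_{2n,1}$ (these are $\log u_i(t)/t$ for the Lam group generators $u_i(t)=I+t\,\mathfrak u_i$). $\mathfrak u_i$ acts on row vectors by right multiplication, $x\mapsto x\mathfrak u_i$, and on $\bigwedge^{n-1}\mathbb R^{2n}$ as a derivation: $\mathfrak u_i(x_1\wedge\cdots\wedge x_{n-1})=\sum_j x_1\wedge\cdots\wedge x_j\mathfrak u_i\wedge\cdots\wedge x_{n-1}$. $V=\{v\in\mathbb R^{2n}:\sum_l(-1)^lv_{2l}=0,\sum_l(-1)^lv_{2l-1}=0\}$; each $\mathfrak u_i$ preserves $V$ and each $w_\sigma\in\bigwedge^{n-1}V$. *)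

(* Defs.v *)
From HB Require Import structures.
From mathcomp Require Import all_boot all_order all_fingroup all_algebra.

Set Implicit Arguments.
Unset Strict Implicit.
Unset Printing Implicit Defensive.

Import GRing.Theory VectorInternalTheory.
Local Open Scope ring_scope.

Definition ksub (k m : nat) := {I : {set 'I_m} | #|I| == k}.
HB.instance Definition _ k m := Finite.on (ksub k m).

(* [enum] lists a set of ordinals in increasing order, so [kelt I] is the
   increasing enumeration i_1 < ... < i_k of I. *)
Definition kelt k m (I : ksub k m) (a : 'I_k) : 'I_m :=
  enum_val (cast_ord (esym (eqP (valP I))) a).

Lemma kelt_inj k m (I : ksub k m) : injective (kelt I).
Proof. by move=> a b /enum_val_inj /cast_ord_inj. Qed.

Lemma keltP k m (I : ksub k m) i :
  reflect (exists a, i = kelt I a) (i \in val I).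
Proof.
apply: (iffP idP) => [iI|[a ->]]; last exact: enum_valP.
exists (cast_ord (eqP (valP I)) (enum_rank_in iI i)).
by rewrite /kelt cast_ordK enum_rankK_in.
Qed.

Lemma kelt_mono k m (I : ksub k m) (a b : 'I_k) :
  (a < b)%N -> (kelt I a < kelt I b)%N.
Proof.
move=> ab; have sz : size (enum (val I)) = k by rewrite -cardE (eqP (valP I)).
rewrite /kelt !(enum_val_nth (kelt I a)) /=.
have srt : sorted ltn (map val (enum (val I))).
  apply: (@subseq_sorted _ ltn ltn_trans _ (map val (enum 'I_m))).
    by apply: map_subseq; rewrite {1}/enum_mem -enumT; apply: filter_subseq.
  by rewrite val_enum_ord; apply: iota_ltn_sorted.
have /= := @sorted_ltn_nth _ ltn ltn_trans 0%N _ srt a b.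
rewrite !inE size_map sz !ltn_ord => /(_ isT isT ab).
by rewrite !(nth_map (kelt I a)) ?sz ?ltn_ord.
Qed.

Definition fupd k (W : eqType) (x : {ffun 'I_k -> W}) (j : 'I_k) (y : W) :=
  [ffun a => if a == j then y else x a].

Section Alternating.
Variables (R : fieldType) (W U : vectType R) (k : nat).
Implicit Types (f : {ffun 'I_k -> W} -> U) (x : {ffun 'I_k -> W}).

Definition multilinear_fun f := forall x j a y z,
  f (fupd x j (a *: y + z)) = a *: f (fupd x j y) + f (fupd x j z).

Definition alternating_fun f := forall x p q,
  p != q -> x p = x q -> f x = 0.

End Alternating.

(* Coordinate model of the k-th exterior power: [wedge x] has as coordinates
   the k x k minors of the matrix of x in the basis of W given by [v2r].
   [wedge_multilinear], [wedge_alternating], [ext_liftE] and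
   [ext_lift_unique] state that it has the universal property. *)
Section ExteriorPower.
Variables (R : fieldType) (k : nat).

Definition extpow (W : vectType R) := {ffun ksub k (dim W) -> R^o}.
HB.instance Definition _ W := Vector.on (extpow W).

Definition wedge (W : vectType R) (x : {ffun 'I_k -> W}) : extpow W :=
  [ffun I => \det (\matrix_(a, b) v2r (x a) 0 (kelt I b))].

Definition basis_fam (W : vectType R) (I : ksub k (dim W)) : {ffun 'I_k -> W} :=
  [ffun a => r2v (delta_mx 0 (kelt I a))].

(* The linear map on the exterior power induced by an alternating multilinear
   map f. *)
Definition ext_lift (W U : vectType R) (f : {ffun 'I_k -> W} -> U)
    (w : extpow W) : U :=
  \sum_I (w I : R) *: f (basis_fam I).

Definition ext_der (W : vectType R) (f : {linear W -> W}) :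
    extpow W -> extpow W :=
  ext_lift (fun x => \sum_j wedge (fupd x j (f (x j)))).

Definition ext_map (W W' : vectType R) (f : {linear W -> W'}) :
    extpow W -> extpow W' :=
  ext_lift (fun x => wedge [ffun a => f (x a)]).

End ExteriorPower.

Section ExteriorTheory.
Variables (R : fieldType) (k : nat).
Implicit Types (W U : vectType R).

Lemma fupd_id (W : eqType) (x : {ffun 'I_k -> W}) j : fupd x j (x j) = x.
Proof. by apply/ffunP => a; rewrite ffunE; case: eqP => [->|]. Qed.

Lemma fupdC (W : eqType) (x : {ffun 'I_k -> W}) p q y z : p != q ->
  fupd (fupd x p y) q z = fupd (fupd x q z) p y.
Proof.
move=> pq; apply/ffunP => a; rewrite !ffunE.
by case: (eqVneq a q) => [->|//]; rewrite eq_sym (negPf pq).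
Qed.

Lemma fupd_upd (W : eqType) (x : {ffun 'I_k -> W}) p y z :
  fupd (fupd x p y) p z = fupd x p z.
Proof. by apply/ffunP => a; rewrite !ffunE; case: eqP. Qed.

Lemma wedge_multilinear W : multilinear_fun (@wedge R k W).
Proof.
move=> x j a y z; apply/ffunP => I; rewrite !ffunE.
rewrite (@determinant_multilinear _ _ _
  (\matrix_(c, b) v2r (fupd x j y c) 0 (kelt I b))
  (\matrix_(c, b) v2r (fupd x j z c) 0 (kelt I b)) j a 1) ?mul1r //.
- by apply/rowP => b; rewrite !mxE !ffunE eqxx linearP !mxE mul1r.
- apply/matrixP => c b; rewrite !mxE !ffunE.
  by rewrite eq_sym (negPf (neq_lift j c)).
- apply/matrixP => c b; rewrite !mxE !ffunE.
  by rewrite eq_sym (negPf (neq_lift j c)).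
Qed.

Lemma wedge_alternating W : alternating_fun (@wedge R k W).
Proof.
move=> x p q pq xpq; apply/ffunP => I; rewrite !ffunE.
by apply: (determinant_alternate pq) => b; rewrite !mxE xpq.
Qed.

Lemma wedge_basis W (I J : ksub k (dim W)) :
  wedge (basis_fam I) J = (J == I)%:R.
Proof.
rewrite ffunE; case: eqP => [->|/eqP JI].
  rewrite -[RHS](det1 R k); congr (\det _); apply/matrixP => a b.
  rewrite !mxE ffunE r2vK !mxE eqxx /= (inj_eq (@kelt_inj _ _ I)).
  by rewrite eq_sym.
have : ~~ (val I \subset val J).
  apply: contra JI => sIJ; rewrite -val_eqE eq_sym eqEcard sIJ /=.
  by rewrite (eqP (valP I)) (eqP (valP J)).
case/subsetPn => i /keltP[a ->] nJ.
rewrite (expand_det_row _ a) big1 // => b _; rewrite !mxE ffunE r2vK !mxE eqxx /=.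
case: eqP => [e|]; last by rewrite mul0r.
by case/negP: nJ; rewrite -e; apply/keltP; exists b.
Qed.

Lemma ext_lift_linear W U (f : {ffun 'I_k -> W} -> U) : linear (ext_lift f).
Proof.
move=> a v w; rewrite /ext_lift scaler_sumr -big_split /=.
by apply: eq_bigr => I _; rewrite !ffunE scalerDl scalerA.
Qed.

Lemma ext_lift_basis W U (f : {ffun 'I_k -> W} -> U) (I : ksub k (dim W)) :
  ext_lift f (wedge (basis_fam I)) = f (basis_fam I).
Proof.
rewrite /ext_lift (bigD1 I) //= wedge_basis eqxx scale1r big1 ?addr0 // => J JI.
by rewrite wedge_basis (negPf JI) scale0r.
Qed.

Lemma extpow_span W (w : extpow k W) :
  w = \sum_I (w I : R) *: wedge (basis_fam I).
Proof.
apply/ffunP => J; rewrite sum_ffunE (bigD1 J) //= ffunE wedge_basis eqxx.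
rewrite big1 ?addr0; first by rewrite [RHS]mulr1.
by move=> I IJ; rewrite ffunE wedge_basis eq_sym (negPf IJ) scaler0.
Qed.

Section Vanishing.
Variables (W U : vectType R) (h : {ffun 'I_k -> W} -> U).
Hypotheses (hM : multilinear_fun h) (hA : alternating_fun h).

Lemma mf_add x j y z : h (fupd x j (y + z)) = h (fupd x j y) + h (fupd x j z).
Proof. by have := hM x j 1 y z; rewrite !scale1r. Qed.

Lemma mf_zero x j : h (fupd x j 0) = 0.
Proof.
have := mf_add x j 0 0; rewrite addr0 => /eqP.
by rewrite -subr_eq subrr => /eqP <-.
Qed.

Lemma mf_sum x j (J : finType) (c : J -> R) (b : J -> W) :
  h (fupd x j (\sum_i c i *: b i)) = \sum_i c i *: h (fupd x j (b i)).
Proof.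
elim: (index_enum J) => [|i s IH].
  by rewrite !big_nil mf_zero.
by rewrite !big_cons hM IH.
Qed.

Lemma alt_swap x p q y z : p != q ->
  h (fupd (fupd x p y) q z) = - h (fupd (fupd x p z) q y).
Proof.
move=> pq; apply/eqP; rewrite -addr_eq0; apply/eqP.
have Z v : h (fupd (fupd x p v) q v) = 0.
  by apply: (hA pq); rewrite !ffunE eqxx (negPf pq) eqxx.
have := Z (y + z); rewrite mf_add !(fupdC x _ _ pq) !mf_add.
by rewrite -!(fupdC x _ _ pq) !Z add0r addr0 addrC.
Qed.

Lemma alt_perm (s : {perm 'I_k}) x : h x = 0 -> h [ffun a => x (s a)] = 0.
Proof.
have [ts -> _] := prod_tpermP s; elim: ts x => [|[p q] ts IH] x hx.
  rewrite big_nil -[RHS]hx; congr h; apply/ffunP => a; rewrite ffunE perm1 //.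
have {}hx := IH _ hx; rewrite big_cons; set t := (\prod_(_ <- _) _)%g in hx *.
have [epq|pq] := eqVneq p q.
  rewrite -[RHS]hx; congr h; apply/ffunP => a.
  by rewrite !ffunE permM /= epq tperm1 perm1.
pose y := [ffun a => x (t a)].
have -> : [ffun a => x ((tperm p q * t)%g a)] = fupd (fupd y p (y q)) q (y p).
  apply/ffunP => a; rewrite !ffunE permM /=.
  by case: tpermP => [->|->|/eqP/negPf-> /eqP/negPf->]; rewrite ?eqxx ?(negPf pq).
by rewrite alt_swap // !fupd_id hx oppr0.
Qed.

Lemma alt_vanish : (forall I, h (basis_fam I) = 0) -> forall x, h x = 0.
Proof.
move=> h0; pose b (i : 'I_(dim W)) : W := r2v (delta_mx 0 i).
have hb (phi : 'I_k -> 'I_(dim W)) : h [ffun a => b (phi a)] = 0.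
  have [/injectiveP ip|/injectivePn[p [q pq e]]] := boolP (injectiveb phi);
    last by apply: (hA pq); rewrite !ffunE e.
  pose A := [set phi a | a in 'I_k].
  have cA : #|A| == k by rewrite card_imset // card_ord.
  pose I : ksub k (dim W) := exist _ A cA.
  have ex a : exists c, phi a == kelt I c.
    by have /keltP[c ->] : phi a \in val I by [apply: imset_f]; exists c.
  pose g a := xchoose (ex a); have gE a : kelt I (g a) = phi a.
    by rewrite (eqP (xchooseP (ex a))).
  have gi : injective g by move=> a c e; apply: ip; rewrite -!gE e.
  rewrite -[RHS](alt_perm (perm gi) (h0 I)); congr h.
  by apply/ffunP => a; rewrite !ffunE permE gE.
suff H m (x : {ffun 'I_k -> W}) : (m <= k)%N ->
    (forall a : 'I_k, (m <= a)%N -> exists i, x a = b i) -> h x = 0.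
  by move=> x; apply: (H k) => // a; rewrite leqNgt ltn_ord.
elim: m x => [|m IH] x mk hx.
  have ex a : exists i, x a == b i by have [i ->] := hx a (leq0n _); exists i.
  rewrite -[RHS](hb (fun a => xchoose (ex a))); congr h.
  by apply/ffunP => a; rewrite ffunE; apply/eqP/(xchooseP (ex a)).
pose j : 'I_k := Ordinal mk.
have xj : x j = \sum_i v2r (x j) 0 i *: b i.
  rewrite -{1}[x j]v2rK {1}[v2r (x j)]row_sum_delta linear_sum /=.
  by apply: eq_bigr => i _; rewrite linearZ.
rewrite -[x](fupd_id _ j) xj mf_sum big1 // => i _.
rewrite IH ?scaler0 // ?(ltnW mk) // => a; rewrite leq_eqVlt ffunE => /orP[/eqP ma|ma].
  by exists i; have -> : a == j by rewrite -val_eqE /= ma.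
have -> : (a == j) = false by rewrite -val_eqE /= gtn_eqF.
exact: hx.
Qed.

End Vanishing.

Lemma ext_liftE W U (f : {ffun 'I_k -> W} -> U) x :
  multilinear_fun f -> alternating_fun f -> ext_lift f (wedge x) = f x.
Proof.
move=> fM fA; apply/eqP; rewrite -subr_eq0; apply/eqP.
apply: (@alt_vanish W U (fun x => ext_lift f (wedge x) - f x)) => {x}.
- move=> x j a y z; rewrite wedge_multilinear ext_lift_linear fM.
  by rewrite scalerBr opprD !addrA -!addrA; congr (_ + _); rewrite addrCA.
- move=> x p q pq e; rewrite (wedge_alternating pq e) (fA _ _ _ pq e) subr0.
  by rewrite /ext_lift big1 // => I _; rewrite ffunE scale0r.
by move=> I; rewrite ext_lift_basis subrr.
Qed.

Lemma ext_lift_unique W U (g h : extpow k W -> U) : linear g -> linear h ->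
  (forall x, g (wedge x) = h (wedge x)) -> g =1 h.
Proof.
move=> gl hl gh w; have lin0 f : linear f -> f 0 = 0 :> U.
  by move=> fl; have := fl (-1) 0 0; rewrite scaler0 addr0 scaleN1r addNr.
rewrite [w]extpow_span; elim: (index_enum _) => [|I s IH].
  by rewrite !big_nil !lin0.
by rewrite !big_cons gl hl gh IH.
Qed.

Lemma ext_derE W (f : {linear W -> W}) x :
  ext_der f (wedge x) = \sum_(j < k) wedge (fupd x j (f (x j))).
Proof.
apply: ext_liftE => {x} [x p a y z | x p q pq e].
  rewrite scaler_sumr -big_split /=; apply: eq_bigr => j _.
  have [->|jp] := eqVneq j p.
    by rewrite !ffunE eqxx !fupd_upd linearP wedge_multilinear.
  rewrite !ffunE (negPf jp) !(fupdC x _ _ (_ : p != j)) 1?eq_sym //.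
  exact: wedge_multilinear.
rewrite (bigD1 p) //= (bigD1 q) 1?eq_sym //= big1 ?addr0; last first.
  move=> j /andP[jp jq]; apply: (wedge_alternating pq); rewrite !ffunE.
  by rewrite ![_ == j]eq_sym (negPf jp) (negPf jq).
apply/eqP; rewrite addr_eq0; apply/eqP.
have := alt_swap (@wedge_multilinear W) (@wedge_alternating W) x (f (x p)) (x p) pq.
rewrite fupd_id -e => <-; congr wedge; apply/ffunP => a; rewrite !ffunE.
by case: (eqVneq a q) => [->|//]; rewrite eq_sym (negPf pq) e.
Qed.

Lemma ext_mapE W W' (f : {linear W -> W'}) (x : {ffun 'I_k -> W}) :
  ext_map f (wedge x) = wedge [ffun a => f (x a)].
Proof.
apply: ext_liftE => {x} [x p a y z | x p q pq e].
  have E v : [ffun c => f (fupd x p v c)] = fupd [ffun c => f (x c)] p (f v).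
    by apply/ffunP => c; rewrite !ffunE; case: eqP.
  by rewrite !E linearP wedge_multilinear.
by apply: (wedge_alternating pq); rewrite !ffunE e.
Qed.

Lemma ext_map_can W W' (f : {linear W -> W'}) (g : {linear W' -> W}) :
  cancel f g -> cancel (@ext_map R k _ _ f) (ext_map g).
Proof.
move=> fK; apply: (@ext_lift_unique W (extpow k W)
  (fun w => ext_map g (ext_map f w)) id) => [a v w||x] //.
  by rewrite /ext_map !ext_lift_linear.
by rewrite !ext_mapE; congr wedge; apply/ffunP => a; rewrite !ffunE fK.
Qed.

End ExteriorTheory.

(* Points of the circle are numbered from 0: the k-th bar is 2k and the k-th
   tilde is 2k+1, for 0 <= k < n. *)
Section Noncrossing.
Variable n : nat.
Implicit Types (sigma tau : {set {set 'I_n}}) (k : 'I_n).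

Lemma bar_subproof k : (k.*2 < n.*2)%N.
Proof. by rewrite ltn_double. Qed.
Lemma tilde_subproof k : (k.*2.+1 < n.*2)%N.
Proof. by rewrite ltn_Sdouble. Qed.
Lemma half_subproof (i : 'I_n.*2) : (i./2 < n)%N.
Proof. by rewrite ltn_half_double. Qed.

Definition bar k : 'I_n.*2 := Ordinal (bar_subproof k).
Definition tilde k : 'I_n.*2 := Ordinal (tilde_subproof k).
Definition half_ord (i : 'I_n.*2) : 'I_n := Ordinal (half_subproof i).

(* Two blocks alternate in the cyclic order iff they alternate in the linear
   order, up to exchanging them. *)
Definition noncrossing m (P : {set {set 'I_m}}) :=
  [forall B in P, forall C in P, (B != C) ==>
    ~~ [exists a in B, exists b in C, exists c in B, exists d in C,
          [&& a < b, b < c & c < d]%N]].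

Definition nc_partition sigma := partition sigma [set: 'I_n] && noncrossing sigma.

Definition interleave sigma tau : {set {set 'I_n.*2}} :=
  [set bar @: B | B : {set 'I_n} in sigma]
  :|: [set tilde @: B | B : {set 'I_n} in tau].

Definition refines tau' tau :=
  [forall B in tau', exists C in tau, B \subset C].

Definition compatible sigma tau :=
  partition tau [set: 'I_n] && noncrossing (interleave sigma tau).

Definition is_dual sigma tau :=
  compatible sigma tau && [forall tau', compatible sigma tau' ==> refines tau' tau].

Definition dual sigma : {set {set 'I_n}} :=
  odflt set0 [pick tau | is_dual sigma tau].

Definition full_partition sigma := interleave sigma (dual sigma).

Definition isolate k sigma : {set {set 'I_n}} :=
  [set k] |: ([set B :\ k | B : {set 'I_n} in sigma] :\ set0).

Definition isolation (i : 'I_n.*2) sigma : {set {set 'I_n}} :=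
  if ~~ odd i then isolate (half_ord i) sigma
  else odflt set0 [pick sigma' | nc_partition sigma' &&
                    (dual sigma' == isolate (half_ord i) (dual sigma))].

Definition concordant sigma (I : {set 'I_n.*2}) :=
  (#|I| == n.-1) && [forall B in full_partition sigma, #|B :\: I| == 1%N].

End Noncrossing.

Section Lam.
Variables (R : fieldType) (n : nat).

Definition e_ (I : ksub n.-1 n.*2) : extpow n.-1 'rV[R]_n.*2 :=
  wedge [ffun a => delta_mx 0 (kelt I a)].

Definition w_ (sigma : {set {set 'I_n}}) : extpow n.-1 'rV[R]_n.*2 :=
  \sum_(I : ksub n.-1 n.*2 | concordant sigma (val I)) e_ I.

(* [ordS] and [ord_pred] are the cyclic successor and predecessor; the sign
   (-1)^n appears when they wrap around. *)
Definition lam (i : 'I_n.*2) : 'M[R]_n.*2 :=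
  (if i.+1 == n.*2 then (-1) ^+ n else 1) *: delta_mx i (ordS i)
  + (if i == 0%N :> nat then (-1) ^+ n else 1) *: delta_mx i (ord_pred i).

(* The exponent is l.+1 because l is numbered from 0. *)
Definition altsum (p : 'I_n -> 'I_n.*2) (v : 'rV[R]_n.*2) : R^o :=
  \sum_(l < n) (-1) ^+ l.+1 * v 0 (p l).

Lemma altsum_linear p : linear (altsum p).
Proof.
move=> a u v; rewrite /altsum scaler_sumr -big_split /=; apply: eq_bigr => l _.
by rewrite !mxE mulrDr mulrCA.
Qed.
HB.instance Definition _ p :=
  GRing.isLinear.Build R 'rV[R]_n.*2 R^o _ (altsum p) (altsum_linear p).

Definition lamV : {vspace 'rV[R]_n.*2} :=
  (lker (linfun (altsum (@tilde n))) :&: lker (linfun (altsum (@bar n))))%VS.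

Lemma mem_lamV v :
  (v \in lamV) = (altsum (@tilde n) v == 0) && (altsum (@bar n) v == 0).
Proof. by rewrite memv_cap !memv_ker !lfunE. Qed.

Lemma altsum_delta (p : 'I_n -> 'I_n.*2) (b : bool) (j : 'I_n.*2) :
  (forall l, p l = b + l.*2 :> nat)%N ->
  altsum p (delta_mx 0 j) = (odd j == b)%:R * (-1) ^+ j./2.+1.
Proof.
move=> pE; rewrite /altsum (bigD1 (half_ord j)) //= big1 ?addr0; last first.
  move=> l lj; rewrite mxE eqxx /=; case: eqP => [e|]; last by rewrite mulr0.
  by case/eqP: lj; apply/val_inj; rewrite /= -e pE half_bit_double.
rewrite mxE eqxx /= mulrC -val_eqE /= pE -{1}[X in _ == X]odd_double_half.
by rewrite eqn_add2r; case: (odd j); case: (b).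
Qed.

Lemma lam_stable (v : 'rV[R]_n.*2) (i : 'I_n.*2) : v *m lam i \in lamV.
Proof.
have row_delta (j : 'I_n.*2) : v *m delta_mx i j = v 0 i *: delta_mx 0 j.
  apply/rowP => l; rewrite !mxE (bigD1 i) //= big1 ?addr0.
    by rewrite mxE eqxx.
  by move=> m mi; rewrite mxE (negPf mi) mulr0.
have key (c1 c2 c P t1 t2 : R) : c1 * t1 + c2 * t2 = 0 ->
    c1 * (c * (P * t1)) + c2 * (c * (P * t2)) = 0.
  move=> e; rewrite ![_ * (c * _)]mulrCA ![_ * (P * _)]mulrCA -!mulrDr e.
  by rewrite !mulr0.
have H (p : 'I_n -> 'I_n.*2) (b : bool) :
    (forall l, p l = b + l.*2 :> nat)%N -> altsum p (v *m lam i) = 0.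
  move=> pE; rewrite /lam mulmxDr -!scalemxAr !row_delta linearD !linearZ /=.
  rewrite !(altsum_delta _ pE) /= {pE}.
  have i2n := ltn_ord i; have n0 : (0 < n)%N.
    by rewrite -double_gt0 (leq_ltn_trans _ i2n).
  have [i0|ni0] := eqVneq (i : nat) 0%N.
    rewrite i0 add0n !modn_small ?prednK ?double_gt0 //; last first.
      by rewrite -{1}(prednK n0) doubleS.
    have -> : (1 == n.*2)%N = false by case: (n) n0.
    have -> : (n.*2.-1 = n.-1.*2.+1)%N by rewrite -{1}(prednK n0) doubleS.
    rewrite /= odd_double uphalf_double prednK //.
    by apply: key; rewrite -expr2 sqrr_sign expr1 mul1r addNr.
  have ip : (i.-1.+1 = i)%N by rewrite prednK // lt0n.
  have -> : ((i + n.*2).-1 %% n.*2 = i.-1)%N.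
    rewrite -ip addSn /= modnDr modn_small //.
    by rewrite (leq_trans _ (ltnW i2n)) // -{2}ip.
  have [il|nil] := eqVneq i.+1 n.*2.
    rewrite il modnn /=; have -> : i.-1 = n.-1.*2.
      by have := congr1 (fun m => m.-2) il; rewrite /= => ->; case: (n) n0.
    rewrite odd_double doubleK prednK //.
    by apply: key; rewrite expr1 mulrN1 mul1r addNr.
  rewrite modn_small; last by rewrite ltn_neqAle nil.
  have -> : odd i.+1 = odd i.-1 by rewrite -{1}ip /= negbK.
  apply: key; rewrite -[X in X.+1./2]ip /= !mul1r [in X in X + _]exprS mulN1r.
  by rewrite addNr.
by rewrite mem_lamV (H _ true) // (H _ false) // eqxx.
Qed.

(* The restriction of the i-th generator to lamV; the projection [vsproj] only
   changes the type, by [lam_resE]. *)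
Definition lam_res (i : 'I_n.*2) : {linear subvs_of lamV -> subvs_of lamV} :=
  vsproj lamV \o mulmxr (lam i) \o vsval.

Lemma lam_resE i x : vsval (lam_res i x) = vsval x *m lam i.
Proof. by rewrite /= vsprojK // lam_stable. Qed.

(* The element of the exterior power of lamV corresponding to w_ sigma: the
   preimage of w_ sigma under the injective map [ext_map vsval], whenever there
   is one (see [wV_unique]). *)
Definition wV_ (sigma : {set {set 'I_n}}) : extpow n.-1 (subvs_of lamV) :=
  ext_map (vsproj lamV) (w_ sigma).

Lemma wV_unique sigma (w : extpow n.-1 (subvs_of lamV)) :
  ext_map vsval w = w_ sigma -> wV_ sigma = w.
Proof.
move=> e; rewrite /wV_ -e; apply: (ext_map_can (f := vsval)) => x.
exact: vsvalK.
Qed.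

End Lam.

(* Main.v *)
Require Import Defs.
From mathcomp Require Import all_boot all_order all_fingroup all_algebra.
From mathcomp Require Import zify reals.

(* A non-crossing partition is encoded by a colouring of the bars. Say that a
   point p separates x and y when it lies between them; for fixed p and q, the
   relation "x and y are separated by both or by neither of p and q" is an
   equivalence. Two tildes lie in the same dual block iff they separate the same
   pairs of equivalent bars, so isolating a point of the circle amounts to
   merging the blocks of its two neighbours.

   The generator u_i replaces i by i - 1 or i + 1 in e_I; the signs (-1)^n
   compensate the reordering when the index wraps around. Hence the coefficient
   of e_J in u_i(w_sigma) counts the neighbours s of i such that exchanging s and
   i in J gives a set concordant with sigma. As the merged blocks are distinct
   when i is not a singleton, this number is 1 if J is concordant with g_i sigma
   and 0 otherwise.

   For the one-block partition, w_sigma is the wedge of the vectors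
   e_(2j-1) + e_(2j+1), which lie in V. Every other w_sigma is obtained from this
   one by generators u_i, which preserve V. *)

Set Implicit Arguments.
Unset Strict Implicit.
Unset Printing Implicit Defensive.

Import GRing.Theory.
Local Open Scope ring_scope.

(** * Partitions as fibres of colourings *)

Section Fibres.
Variable m : nat.

Definition fibres (T : eqType) (c : 'I_m -> T) : {set {set 'I_m}} :=
  preim_partition c [set: 'I_m].

Lemma fibresP (T : eqType) (c : 'I_m -> T) (B : {set 'I_m}) :
  reflect (exists x, B = [set y | c x == c y]) (B \in fibres c).
Proof.
apply: (iffP imsetP) => [[x _ ->]|[x ->]]; exists x => //;
  by apply/setP => y; rewrite !inE.
Qed.

Lemma mem_fibres (T : eqType) (c : 'I_m -> T) x : [set y | c x == c y] \in fibres c.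
Proof. by apply/fibresP; exists x. Qed.

Lemma fibres_partition (T : eqType) (c : 'I_m -> T) :
  partition (fibres c) [set: 'I_m].
Proof. exact: preim_partitionP. Qed.

Lemma partition_fibres (P : {set {set 'I_m}}) :
  partition P [set: 'I_m] -> P = fibres (pblock P).
Proof. by move=> hP; rewrite /fibres preim_partition_pblock. Qed.

Lemma eq_fibresP (T U : eqType) (c : 'I_m -> T) (d : 'I_m -> U) :
  fibres c = fibres d <-> (forall x y, (c x == c y) = (d x == d y)).
Proof.
split=> [e x y|e].
  have: [set y | c x == c y] \in fibres d by rewrite -e mem_fibres.
  case/fibresP => z /setP ez; have := ez x; have := ez y.
  by rewrite !inE eqxx => -> /esym/eqP ->.
by apply/setP => B; apply/fibresP/fibresP => -[x ->]; exists x;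
  apply/setP => y; rewrite !inE e.
Qed.

Lemma set1_fibres (T : eqType) (c : 'I_m -> T) i :
  reflect (forall j, c i = c j -> j = i) ([set i] \in fibres c).
Proof.
apply: (iffP (fibresP _ _)) => [[x /setP e] j cij|h].
  have := e i; have := e j; rewrite !inE eqxx -cij => h1 /esym h2.
  by move: h1; rewrite h2 => /eqP.
by exists i; apply/setP => j; rewrite !inE; apply/eqP/eqP => [->|/h].
Qed.

Lemma refines_fibres (T U : eqType) (c : 'I_m -> T) (d : 'I_m -> U) :
  reflect (forall x y, c x = c y -> d x = d y) (refines (fibres c) (fibres d)).
Proof.
apply: (iffP forall_inP) => [h x y cxy|h B /fibresP[x ->]].
  have /exists_inP[C /fibresP[z ->] /subsetP s] := h _ (mem_fibres c x).
  have /eqP ex : d z == d x by have := s x; rewrite !inE => ->.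
  have /eqP ey : d z == d y by have := s y; rewrite !inE cxy => ->.
  by rewrite -ex -ey.
apply/exists_inP; exists [set y | d x == d y]; first exact: mem_fibres.
by apply/subsetP => y; rewrite !inE => /eqP /h ->.
Qed.

End Fibres.

(** * Separation of points and non-crossing colourings *)

Definition separates (p x y : nat) : bool := (p < x)%N (+) (p < y)%N.

Lemma separatesxx p x : separates p x x = false.
Proof. exact: addbb. Qed.

Lemma separatesC p x y : separates p x y = separates p y x.
Proof. exact: addbC. Qed.

Lemma separates_trans y p x z :
  separates p x z = separates p x y (+) separates p y z.
Proof. by rewrite /separates -addbA (addbA (p < y)%N) addbb. Qed.

(** Two chords do not cross when the ends of one lie on the same side of the other. Stated as a
    parity, this does not depend on the order of the four points and can be chained by
    [separates_trans]. *)
Definition nc_colouring m (T : eqType) (c : 'I_m -> T) :=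
  forall x y p q, c x = c y -> c p = c q -> c x <> c p ->
  separates p x y = separates q x y.

(** Neither of x, y is one of p, q, as the two colours differ. A failure of the parity is then one
    of the eight alternating orders of x, y with p, q, each excluded by [nocross]. *)
Lemma noncrossing_fibres m (T : eqType) (c : 'I_m -> T) :
  noncrossing (fibres c) <-> nc_colouring c.
Proof.
split=> [/forall_inP nc x y p q cxy cpq cxp|nc].
  have nocross (a b a' b' : 'I_m) : c a = c a' -> c b = c b' -> c a <> c b ->
      (a < b)%N -> (b < a')%N -> (a' < b')%N -> False.
    move=> ca cb /eqP cab ab ba' a'b'.
    have nab : [set y | c a == c y] != [set y | c b == c y].
      by apply: contra cab => /eqP/setP/(_ b); rewrite !inE eqxx.
    have /forall_inP := nc _ (mem_fibres c a).
    move=> /(_ _ (mem_fibres c b)) /implyP/(_ nab)/negP; apply.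
    apply/exists_inP; exists a; rewrite ?inE //.
    apply/exists_inP; exists b; rewrite ?inE //.
    apply/exists_inP; exists a'; rewrite ?inE -?ca //.
    apply/exists_inP; exists b'; rewrite ?inE -?cb //.
    by rewrite ab ba' a'b'.
  have neq (u v : 'I_m) : c u <> c v -> u <> v :> nat.
    by move=> h /val_inj e; apply: h; rewrite e.
  have [npx npy] : p <> x :> nat /\ p <> y :> nat.
    by split; apply: neq; rewrite -?cxy => /esym.
  have [nqx nqy] : q <> x :> nat /\ q <> y :> nat.
    by split; apply: neq; rewrite -?cxy -?cpq => /esym.
  have cpx : c p <> c x by move/esym.
  have := (nocross x p y q cxy cpq cxp, nocross x q y p cxy (esym cpq)).
  have := (nocross y p x q (esym cxy) cpq, nocross y q x p (esym cxy) (esym cpq)).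
  have := (nocross p x q y cpq cxy cpx, nocross p y q x cpq (esym cxy)).
  have := (nocross q x p y (esym cpq) cxy, nocross q y p x (esym cpq) (esym cxy)).
  rewrite -!cxy -!cpq /separates; move: cxp cpx npx npy nqx nqy.
  move: (c x) (c p) => u v cuv cvu npx npy nqx nqy.
  move=> [/(_ cvu) h1 /(_ cvu) h2] [h3 /(_ cvu) h4].
  move=> [/(_ cuv) h5 /(_ cuv) h6] [h7 /(_ cuv) h8].
  lia.
apply/forall_inP => B /fibresP[x ->]; apply/forall_inP => C /fibresP[p ->].
apply/implyP => xp; apply/negP => /exists_inP[a]; rewrite inE => /eqP xa.
case/exists_inP => b; rewrite inE => /eqP pb /exists_inP[a']; rewrite inE => /eqP xa'.
case/exists_inP => b'; rewrite inE => /eqP pb' /and3P[ab ba' a'b'].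
have nxp : c x <> c p by move=> e; rewrite e eqxx in xp.
have := nc a a' b b'; rewrite -xa -xa' -pb -pb' => /(_ erefl erefl nxp).
by rewrite /separates; lia.
Qed.

(** * The dual partition as a colouring *)

Section Colourings.
Variable n : nat.

Definition mix_colouring (T U : eqType) (c : 'I_n -> T) (d : 'I_n -> U)
    (i : 'I_n.*2) : (T + U)%type :=
  if odd i then inr (d (half_ord i)) else inl (c (half_ord i)).

(* Two tildes are dual-equivalent when no pair of equivalent bars is separated
   by exactly one of them; the colour of a tilde records the set of pairs that
   it separates. *)
Definition dual_colouring (T : eqType) (c : 'I_n -> T) (a : 'I_n) :
    {ffun 'I_n * 'I_n -> bool} :=
  [ffun xy => (c xy.1 == c xy.2) && separates a xy.1 xy.2].

Definition isolate_colouring (T : eqType) (k : 'I_n) (c : 'I_n -> T) (x : 'I_n) :=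
  if x == k then None else Some (c x).

Definition full_colouring (T : eqType) (c : 'I_n -> T) :=
  mix_colouring c (dual_colouring c).

Lemma half_bar (k : 'I_n) : half_ord (bar k) = k.
Proof. by apply: val_inj; rewrite /= doubleK. Qed.

Lemma half_tilde (k : 'I_n) : half_ord (tilde k) = k.
Proof. by apply: val_inj; rewrite /= uphalf_double. Qed.

Lemma odd_bar (k : 'I_n) : odd (bar k) = false.
Proof. by rewrite /= odd_double. Qed.

Lemma odd_tilde (k : 'I_n) : odd (tilde k) = true.
Proof. by rewrite /= odd_double. Qed.

Lemma bar_or_tilde (i : 'I_n.*2) :
  i = if odd i then tilde (half_ord i) else bar (half_ord i).
Proof.
by apply: val_inj; case: ifP => o /=; rewrite -[LHS]odd_double_half o.
Qed.

Variant bar_tilde_spec : 'I_n.*2 -> bool -> Type :=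
| IsBar k : bar_tilde_spec (bar k) false
| IsTilde k : bar_tilde_spec (tilde k) true.

Lemma bar_tildeP i : bar_tilde_spec i (odd i).
Proof.
rewrite {1}(bar_or_tilde i).
by case: (odd i); constructor.
Qed.

Lemma bar_inj : injective (@bar n).
Proof. by move=> x y e; rewrite -[x]half_bar e half_bar. Qed.

Lemma tilde_inj : injective (@tilde n).
Proof. by move=> x y e; rewrite -[x]half_tilde e half_tilde. Qed.

Lemma bar_neq_tilde (j k : 'I_n) : (bar j == tilde k) = false.
Proof. by apply/eqP => /(congr1 (fun i : 'I__ => odd i)); rewrite odd_bar odd_tilde. Qed.

Lemma mix_bar (T U : eqType) (c : 'I_n -> T) (d : 'I_n -> U) k :
  mix_colouring c d (bar k) = inl (c k).
Proof. by rewrite /mix_colouring odd_bar half_bar. Qed.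

Lemma mix_tilde (T U : eqType) (c : 'I_n -> T) (d : 'I_n -> U) k :
  mix_colouring c d (tilde k) = inr (d k).
Proof. by rewrite /mix_colouring odd_tilde half_tilde. Qed.

Lemma interleave_fibres (T U : eqType) (c : 'I_n -> T) (d : 'I_n -> U) :
  interleave (fibres c) (fibres d) = fibres (mix_colouring c d).
Proof.
have bE x : @bar n @: [set y | c x == c y] =
    [set j | mix_colouring c d (bar x) == mix_colouring c d j].
  apply/setP => j; rewrite inE mix_bar; apply/imsetP/eqP => [[y]|].
    by rewrite inE => /eqP e ->; rewrite mix_bar e.
  case: (bar_tildeP j) => k; rewrite ?mix_bar ?mix_tilde // => -[e].
  by exists k; rewrite ?inE ?e.
have tE x : @tilde n @: [set y | d x == d y] =
    [set j | mix_colouring c d (tilde x) == mix_colouring c d j].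
  apply/setP => j; rewrite inE mix_tilde; apply/imsetP/eqP => [[y]|].
    by rewrite inE => /eqP e ->; rewrite mix_tilde e.
  case: (bar_tildeP j) => k; rewrite ?mix_bar ?mix_tilde // => -[e].
  by exists k; rewrite ?inE ?e.
apply/setP => B; apply/setUP/fibresP => [[]|[i ->]].
- by case/imsetP => C /fibresP[x ->] ->; exists (bar x).
- by case/imsetP => C /fibresP[x ->] ->; exists (tilde x).
case: (bar_tildeP i) => k; [left|right].
  by rewrite -bE; apply: imset_f; apply: mem_fibres.
by rewrite -tE; apply: imset_f; apply: mem_fibres.
Qed.

Lemma dual_colouringP (T : eqType) (c : 'I_n -> T) a b :
  dual_colouring c a = dual_colouring c b <->
  (forall x y, c x = c y -> separates a x y = separates b x y).
Proof.
split=> [/ffunP e x y cxy|e].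
  by have := e (x, y); rewrite !ffunE /= cxy eqxx.
by apply/ffunP => -[x y]; rewrite !ffunE /=; case: eqP => //= /e ->.
Qed.

Lemma isolate_colouringP (T : eqType) k (c : 'I_n -> T) x y :
  (isolate_colouring k c x == isolate_colouring k c y) =
  ((x == k) == (y == k)) && ((x == k) || (c x == c y)).
Proof. by rewrite /isolate_colouring; case: (x =P k); case: (y =P k). Qed.

Lemma isolate_fibres (T : eqType) k (c : 'I_n -> T) :
  isolate k (fibres c) = fibres (isolate_colouring k c).
Proof.
have E x : x != k -> [set y | c x == c y] :\ k =
    [set y | isolate_colouring k c x == isolate_colouring k c y].
  move=> xk; apply/setP => y; rewrite !inE isolate_colouringP (negPf xk) /=.
  by case: (y == k).
apply/setP => B; rewrite !inE; apply/orP/fibresP => [[/eqP->|]|[x ->]].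
- exists k; apply/setP => y; rewrite !inE isolate_colouringP eqxx /= andbT.
  by rewrite [RHS]eq_sym eqb_id.
- case/andP => B0 /imsetP[C /fibresP[x ->] eB]; move: B0; rewrite eB.
  case/set0Pn => y; rewrite !inE => /andP[yk /eqP exy].
  by exists y; rewrite -E // exy.
have [->|xk] := eqVneq x k.
  left; apply/eqP/setP => y; rewrite !inE isolate_colouringP eqxx /= andbT.
  by rewrite [LHS]eq_sym eqb_id.
right; rewrite -E //; apply/andP; split.
  by apply/set0Pn; exists x; rewrite !inE xk eqxx.
by apply: (imset_f (fun B : {set _} => B :\ k)); apply: mem_fibres.
Qed.

(** The tilde a comes just after the bar a, which is what the strict inequality in [separates]
    encodes. *)
Lemma separates_tilde_bar (a x y : 'I_n) :
  separates (tilde a) (bar x) (bar y) = separates a x y.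
Proof. rewrite /separates /=; lia. Qed.

(** Crossing is symmetric: the chord of the tildes a, b crosses that of the bars x, y iff the latter
    crosses the former. *)
Lemma separates_bar_tilde (a b x y : 'I_n) :
  (separates (bar x) (tilde a) (tilde b) == separates (bar y) (tilde a) (tilde b)) =
  (separates a x y == separates b x y).
Proof. rewrite /separates /=; lia. Qed.

(** Two pairs of bars do not cross by hypothesis, and a pair of bars does not cross a pair of tildes
    by the choice of [dual_colouring]. Only two pairs of tildes need an argument. *)
Lemma nc_full (T : eqType) (c : 'I_n -> T) :
  nc_colouring c -> nc_colouring (full_colouring c).
Proof.
move=> nc x y p q.
case: (bar_tildeP x) => {}x; case: (bar_tildeP y) => {}y; rewrite /full_colouring ?mix_bar ?mix_tilde //;
case: (bar_tildeP p) => {}p; case: (bar_tildeP q) => {}q; rewrite ?mix_bar ?mix_tilde //.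
- move=> -[cxy] -[cpq] nxp; have := nc _ _ _ _ cxy cpq (fun e => nxp (congr1 inl e)).
  by rewrite /separates /= !ltn_double.
- by move=> -[cxy] -[/dual_colouringP cpq] _; rewrite !separates_tilde_bar cpq.
- move=> -[/dual_colouringP cxy] -[cpq] _; apply/eqP.
  by rewrite separates_bar_tilde cxy.
(* The tildes separating u and v form an interval, whereas x, y and p, q
   alternate. *)
move=> -[/dual_colouringP exy] -[/dual_colouringP epq] nxp.
apply/eqP/contraT => /eqP h; exfalso; apply: nxp; congr inr.
apply/dual_colouringP => u v cuv; move: (exy _ _ cuv) (epq _ _ cuv) h.
by rewrite /separates /=; lia.
Qed.

(** Compatibility forces tildes of one block to separate the same pairs of equivalent bars, so every
    compatible partition refines these fibres. They are compatible themselves by [nc_full], hence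
    the coarsest. *)
Lemma dual_fibres (T : eqType) (c : 'I_n -> T) :
  nc_colouring c -> dual (fibres c) = fibres (dual_colouring c).
Proof.
move=> nc.
have E tau : compatible (fibres c) tau -> refines tau (fibres (dual_colouring c)).
  case/andP => /partition_fibres ->; rewrite interleave_fibres.
  move/noncrossing_fibres => nct; apply/refines_fibres => a b tab.
  apply/dual_colouringP => x y cxy; rewrite -!separates_tilde_bar.
  by apply: nct; rewrite ?mix_bar ?mix_tilde ?cxy ?tab.
have D : compatible (fibres c) (fibres (dual_colouring c)).
  rewrite /compatible fibres_partition interleave_fibres.
  exact/noncrossing_fibres/nc_full.
rewrite /dual; case: pickP => [tau|] /=.
  case/andP => ctau /forallP/(_ (fibres (dual_colouring c))) /implyP/(_ D).
  move: (E _ ctau); case/andP: ctau => /partition_fibres -> _.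
  move=> /refines_fibres h1 /refines_fibres h2; apply/eq_fibresP => a b.
  by apply/eqP/eqP => [/h1|/h2].
move/(_ (fibres (dual_colouring c))); rewrite /is_dual D /= => /negP[].
by apply/forallP => tau; apply/implyP/E.
Qed.

Lemma full_partition_fibres (T : eqType) (c : 'I_n -> T) :
  nc_colouring c -> full_partition (fibres c) = fibres (full_colouring c).
Proof. by move=> nc; rewrite /full_partition dual_fibres // interleave_fibres. Qed.

Lemma nc_partition_fibres (T : eqType) (c : 'I_n -> T) :
  nc_colouring c -> nc_partition (fibres c).
Proof. by move=> nc; rewrite /nc_partition fibres_partition; apply/noncrossing_fibres. Qed.

Lemma nc_partition_pblock (sigma : {set {set 'I_n}}) :
  nc_partition sigma -> sigma = fibres (pblock sigma) /\ nc_colouring (pblock sigma).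
Proof.
case/andP => /partition_fibres e nc; split=> //.
by apply/noncrossing_fibres; rewrite -e.
Qed.

End Colourings.

(** * Isolation as a merging of blocks on the other side *)

Section Isolation.
Variable n : nat.

Definition merge_colouring m (T : eqType) (u v : 'I_m) (c : 'I_m -> T) (x : 'I_m) :=
  if c x == c v then c u else c x.

Lemma merge_colouringP m (T : eqType) (u v : 'I_m) (c : 'I_m -> T) x y :
  merge_colouring u v c x = merge_colouring u v c y <->
  [\/ c x = c y, c x = c u /\ c y = c v | c x = c v /\ c y = c u].
Proof.
rewrite /merge_colouring; case: eqP => [xv|nxv]; case: eqP => [yv|nyv]; split.
- by move=> _; apply: Or31; rewrite xv.
- by [].
- by move=> uy; apply: Or33.
- by case=> [xy|[_ //]|[_ //]]; case: nyv; rewrite -xy.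
- by move=> uy; apply: Or32.
- by case=> [xy|[//]|[//]]; case: nxv; rewrite xy.
- by move=> xy; apply: Or31.
- by case=> [//|[_ //]|[//]].
Qed.

(** The only tilde between the bars k and k + 1 is the tilde k. When k is the last bar, [ordS k] is
    0 and all truth values are complemented; the sum over a and b cancels this. *)
Lemma separates_ordS (a b k : 'I_n) :
  separates a k (ordS k) (+) separates b k (ordS k) = (a == k) (+) (b == k).
Proof.
rewrite /separates /= -!val_eqE /=.
have [[ha hb] hk] := (ltn_ord a, ltn_ord b, ltn_ord k).
have [e|/eqP lt] := eqVneq k.+1 n; first by rewrite e modnn; lia.
by rewrite modn_small; lia.
Qed.

Lemma ord_predE (k : 'I_n) : ord_pred k = (if k == 0%N :> nat then n.-1 else k.-1) :> nat.
Proof.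
rewrite /=; case: k => -[|k] hk /=; first by rewrite modn_small; lia.
by rewrite modnDr modn_small; lia.
Qed.

(** The bar k is the only one between the two tildes. For k = 0 the preceding tilde is the last one,
    which separates no bars, and the formula still holds. *)
Lemma separates_ord_pred (x y k : 'I_n) :
  separates (ord_pred k) x y (+) separates k x y = (x == k) (+) (y == k).
Proof.
rewrite /separates ord_predE -!val_eqE /=.
have [[hx hy] hk] := (ltn_ord x, ltn_ord y, ltn_ord k).
by case: eqP => [->|h]; lia.
Qed.

Lemma nc_isolate (T : eqType) (c : 'I_n -> T) k :
  nc_colouring c -> nc_colouring (isolate_colouring k c).
Proof.
move=> nc x y p q /eqP; rewrite isolate_colouringP => /andP[/eqP xy].
case: (x =P k) xy => [->|xk] yk /=.
  by move/esym/eqP: yk => -> _ _ _; rewrite !separatesxx.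
move/eqP => cxy /eqP; rewrite isolate_colouringP => /andP[/eqP pq].
case: (p =P k) pq => [->|pk] qk /=; first by move/esym/eqP: qk => ->.
move=> /eqP cpq /eqP; rewrite isolate_colouringP.
by case: (x =P k) => // _; case: (p =P k) => //= _ /eqP; apply: nc.
Qed.

(** A chord joining the two merged blocks is replaced by the path x, k, [ordS k], y: its ends are
    chords of c, and no chord of another block crosses its middle, as k and [ordS k] are adjacent.
    Claim [B] is claim [A] with the two pairs exchanged. *)
Lemma nc_merge (T : eqType) (c : 'I_n -> T) k :
  nc_colouring c -> nc_colouring (merge_colouring k (ordS k) c).
Proof.
move=> nc.
have A (x y p q : 'I_n) : c x = c k -> c y = c (ordS k) -> c p = c q ->
    c p <> c k -> c p <> c (ordS k) -> separates p x y = separates q x y.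
  move=> xk yk pq pk pk'.
  rewrite (separates_trans k p) (separates_trans k q).
  rewrite (separates_trans (ordS k) p k) (separates_trans (ordS k) q k).
  have -> : separates p x k = separates q x k by apply: nc => //; rewrite xk => /esym.
  have -> : separates p (ordS k) y = separates q (ordS k) y.
    by apply: nc => // /esym.
  have -> // : separates p k (ordS k) = separates q k (ordS k).
  have := separates_ordS p q k.
  have -> : (p == k) = false by apply/eqP => e; apply: pk; rewrite e.
  have -> : (q == k) = false by apply/eqP => e; apply: pk; rewrite pq e.
  by move/addbP => /=; case: (separates p _ _); case: (separates q _ _).
have B (x y p q : 'I_n) : c x = c y -> c p = c k -> c q = c (ordS k) ->
    c x <> c k -> c x <> c (ordS k) -> separates p x y = separates q x y.
  move=> xy pk qk xk xk'; have := A p q x y pk qk xy xk xk'.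
  have neq (u v : 'I_n) : c u <> c v -> u <> v :> nat.
    by move=> h /val_inj e; apply: h; rewrite e.
  have := (neq x p, neq x q, neq y p, neq y q).
  rewrite -xy pk qk /separates => -[[[/(_ xk) h1 /(_ xk') h2] /(_ xk) h3] /(_ xk') h4].
  lia.
move=> x y p q /merge_colouringP xy /merge_colouringP pq nxp.
have N1 : c x <> c p by move=> h; apply: nxp; apply/merge_colouringP; apply: Or31.
have N2 : ~ (c x = c k /\ c p = c (ordS k)).
  by move=> h; apply: nxp; apply/merge_colouringP; apply: Or32.
have N3 : ~ (c x = c (ordS k) /\ c p = c k).
  by move=> h; apply: nxp; apply/merge_colouringP; apply: Or33.
case: xy => [xy|[xk yk]|[xk yk]]; case: pq => [pq|[pk qk]|[pk qk]].
- exact: nc.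
- by apply: B => // e; [apply: N1; rewrite pk|apply: N3].
- by symmetry; apply: B => // e; [apply: N2|apply: N1; rewrite pk].
- by apply: A => // e; [apply: N1; rewrite xk|apply: N2].
- by case: N1; rewrite xk.
- by case: N2.
- by rewrite !(separatesC _ x); apply: A => // e; [apply: N3|apply: N1; rewrite xk].
- by case: N3.
- by case: N1; rewrite xk.
Qed.

(** The new pair k, [ordS k] splits the tilde k from all others. Every other new pair is reached
    from this one through pairs already equivalent for c, so it splits nothing more. *)
Lemma dual_merge (T : eqType) (c : 'I_n -> T) k a b :
  (dual_colouring (merge_colouring k (ordS k) c) a ==
   dual_colouring (merge_colouring k (ordS k) c) b) =
  (isolate_colouring k (dual_colouring c) a ==
   isolate_colouring k (dual_colouring c) b).
Proof.
rewrite isolate_colouringP; apply/eqP/andP.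
  move/dual_colouringP => h; have ak : (a == k) = (b == k).
    have := separates_ordS a b k; rewrite h ?addbb.
      by case: (a == k); case: (b == k).
    by apply/merge_colouringP; apply: Or32.
  split; first exact/eqP.
  apply/orP; right; apply/eqP/dual_colouringP => x y cxy.
  by apply: h; apply/merge_colouringP; apply: Or31.
case=> /eqP ak e; have {}e : dual_colouring c a = dual_colouring c b.
  case/orP: e => [/eqP e|/eqP //].
  by move: ak; rewrite e eqxx => /esym/eqP ->.
have /dual_colouringP E := e; apply/dual_colouringP => x y.
have A u v : c u = c k -> c v = c (ordS k) -> separates a u v = separates b u v.
  move=> uk vk; rewrite (separates_trans k a) (separates_trans k b) (E _ _ uk).
  rewrite (separates_trans (ordS k) a k) (separates_trans (ordS k) b k).
  rewrite (E _ _ (esym vk)); congr (_ (+) (_ (+) _)).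
  have := separates_ordS a b k; rewrite ak addbb.
  by case: (separates a _ _); case: (separates b _ _).
case/merge_colouringP => [|[xk yk]|[xk yk]]; first exact: E.
  exact: A.
by rewrite !(separatesC _ x); apply: A.
Qed.

(** This serves to recover a partition from its dual. Cyclically, x lies in a gap between two
    successive points of the block of y; a and b are the first and last tildes of this gap, and no
    other block leaves the gap without crossing that of y. *)
Lemma separating_dual_pair (T : eqType) (c : 'I_n -> T) (x y : 'I_n) :
  nc_colouring c -> c x <> c y -> (x < y)%N ->
  exists a b, dual_colouring c a = dual_colouring c b /\
              separates a x y <> separates b x y.
Proof.
move=> nc cxy xy.
pose d' := [arg min_(z < y | (c z == c y) && (x < z)%N) z].
have [cd' xd' d'min] : [/\ c d' = c y, (x < d')%N &
    forall z : 'I_n, c z = c y -> (x < z)%N -> (d' <= z)%N].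
  rewrite /d'; case: arg_minnP => [|z /andP[/eqP cz xz] h]; first by rewrite eqxx xy.
  by split=> // t ct xt; apply: h; rewrite ct eqxx xt.
(* The tilde just before the bar d'. *)
have [b eb] : exists b : 'I_n, b.+1 = d'.
  have h : (d'.-1 < n)%N by have := ltn_ord d'; lia.
  by exists (Ordinal h) => /=; lia.
have neq (u v : 'I_n) : c u <> c v -> u <> v :> nat.
  by move=> h /val_inj e; apply: h; rewrite e.
have nx := neq _ _ cxy.
(* a is the last point of the block of y before x, or, if there is none, the
   last point of this block: in both cases the tildes a and b bound an interval
   of bars that is a union of blocks and contains exactly one of x and y. *)
have [a [ca aP sab]] : exists a : 'I_n, [/\ c a = c y,
    (forall u v : 'I_n, c u = c y -> c v = c y -> separates a u v = separates b u v) &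
    separates a x y <> separates b x y].
  have [/existsP[d0 /andP[/eqP cd0 d0x]]|/existsPn no] :=
    boolP [exists d : 'I_n, (c d == c y) && (d < x)%N].
    pose d := [arg max_(z > d0 | (c z == c y) && (z < x)%N) z].
    have [cd dx dmax] : [/\ c d = c y, (d < x)%N &
        forall z : 'I_n, c z = c y -> (z < x)%N -> (z <= d)%N].
      rewrite /d; case: arg_maxnP => [|z /andP[/eqP cz xz] h].
        by rewrite cd0 eqxx d0x.
      by split=> // t ct xt; apply: h; rewrite ct eqxx xt.
    exists d; split=> // [u v cu cv|].
      move: (d'min u cu) (d'min v cv) (dmax u cu) (dmax v cv).
      have nu : u <> x :> nat by apply: neq; rewrite cu => /esym.
      have nv : v <> x :> nat by apply: neq; rewrite cv => /esym.
      rewrite /separates; lia.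
    by have := d'min y erefl xy; rewrite /separates; lia.
  pose d := [arg max_(z > y | c z == c y) z].
  have [cd dmax] : c d = c y /\ forall z : 'I_n, c z = c y -> (z <= d)%N.
    rewrite /d; case: arg_maxnP => [|z /eqP cz h]; first by rewrite eqxx.
    by split=> // t ct; apply: h; rewrite ct.
  exists d; split=> // [u v cu cv|].
    move: (d'min u cu) (d'min v cv) (dmax u cu) (dmax v cv).
    have nu : u <> x :> nat by apply: neq; rewrite cu => /esym.
    have nv : v <> x :> nat by apply: neq; rewrite cv => /esym.
    have := no u; have := no v; rewrite cu cv eqxx /separates /=; lia.
  by move: (d'min y erefl xy) (dmax y erefl); rewrite /separates; lia.
exists a, b; split=> //; apply/dual_colouringP => u v cuv.
have [cu|/eqP nu] := eqVneq (c u) (c y); first by apply: aP; rewrite -?cuv.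
have nud : u <> d' :> nat by apply: neq; rewrite cd'.
have nvd : v <> d' :> nat by apply: neq; rewrite cd' -cuv.
have := nc u v a d' cuv; rewrite ca cd' => /(_ erefl nu).
by rewrite /separates; lia.
Qed.

(** Two bars equivalent for g but not for f would be separated by only one of two tildes equivalent
    for f, hence for g, against the definition of the dual of g. *)
Lemma dual_colouring_inj (T U : eqType) (c : 'I_n -> T) (d : 'I_n -> U) :
  nc_colouring c -> nc_colouring d ->
  (forall a b, (dual_colouring c a == dual_colouring c b) =
               (dual_colouring d a == dual_colouring d b)) ->
  forall x y, (c x == c y) = (d x == d y).
Proof.
suff H (V W : eqType) (f : 'I_n -> V) (g : 'I_n -> W) : nc_colouring f ->
    (forall a b, (dual_colouring f a == dual_colouring f b) =
               (dual_colouring g a == dual_colouring g b)) ->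
    forall x y, g x = g y -> f x = f y.
  by move=> nc nd e x y; apply/eqP/eqP; apply: H.
move=> nf e x y gxy; apply/eqP; apply/negPn/negP => /eqP fxy.
have Habs (u v : 'I_n) : f u <> f v -> g u = g v -> (u < v)%N -> False.
  move=> fuv guv uv; have [a [b [/eqP]]] := separating_dual_pair nf fuv uv.
  by rewrite e => /eqP/dual_colouringP/(_ _ _ guv) ->.
case: (ltngtP x y) => [xy|yx|/val_inj exy]; first exact: (Habs x y).
  by apply: (Habs y x) => //; move/esym.
by apply: fxy; rewrite exy.
Qed.

Lemma isolation_bar_fibres (T : eqType) (c : 'I_n -> T) k :
  isolation (bar k) (fibres c) = fibres (isolate_colouring k c).
Proof. by rewrite /isolation odd_bar half_bar isolate_fibres. Qed.

(** The merged partition has the required dual by [dual_merge], so the default [set0] is not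
    reached; [dual_colouring_inj] shows that the partition picked is this one. *)
Lemma isolation_tilde_fibres (T : eqType) (c : 'I_n -> T) k : nc_colouring c ->
  isolation (tilde k) (fibres c) = fibres (merge_colouring k (ordS k) c).
Proof.
move=> nc; have ncm := @nc_merge _ _ k nc.
have de : fibres (dual_colouring (merge_colouring k (ordS k) c)) =
          fibres (isolate_colouring k (dual_colouring c)).
  exact/eq_fibresP/dual_merge.
rewrite /isolation odd_tilde half_tilde /= dual_fibres // isolate_fibres.
case: pickP => [sigma|] /=.
  case/andP => /nc_partition_pblock[es ncs]; rewrite es dual_fibres // -de.
  move/eqP/eq_fibresP => e; apply/eq_fibresP.
  exact: dual_colouring_inj.
by move/(_ (fibres (merge_colouring k (ordS k) c)));
  rewrite nc_partition_fibres // dual_fibres // de eqxx.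
Qed.

(** Isolating the bar k drops only the pairs of k with another bar, and these are the pairs on which
    the tildes k and [ord_pred k] differ. If a and b become equivalent without being so before, they
    disagree on all the dropped pairs, and each is equivalent to one of these two tildes. *)
Lemma dual_isolate (T : eqType) (c : 'I_n -> T) (k z0 : 'I_n) : nc_colouring c ->
  c z0 = c k -> z0 <> k -> forall a b,
  (dual_colouring (isolate_colouring k c) a ==
   dual_colouring (isolate_colouring k c) b) =
  (merge_colouring k (ord_pred k) (dual_colouring c) a ==
   merge_colouring k (ord_pred k) (dual_colouring c) b).
Proof.
move=> nc cz0 z0k a b.
have isoP (u v : 'I_n) : u <> k -> v <> k -> c u = c v ->
    isolate_colouring k c u = isolate_colouring k c v.
  move=> uk vk cuv; apply/eqP; rewrite isolate_colouringP cuv eqxx orbT andbT.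
  by apply/eqP; case: eqP => //; case: eqP.
have predE (u v : 'I_n) : separates (ord_pred k) u v =
    separates k u v (+) ((u == k) (+) (v == k)).
  by rewrite -separates_ord_pred addbC -addbA addbb addbF.
have neqK (u : 'I_n) : u <> k -> (u == k) = false by move/eqP/negPf.
have neq (u v : 'I_n) : c u <> c v -> u <> v :> nat.
  by move=> h /val_inj e; apply: h; rewrite e.
apply/eqP/eqP => [/dual_colouringP h|]; last first.
  move=> m; have {m} h (u v : 'I_n) : u <> k -> v <> k -> c u = c v ->
      separates a u v = separates b u v.
    move=> uk vk cuv; case/merge_colouringP: m => [|[]|[]].
    - by move/dual_colouringP; apply.
    - move=> /dual_colouringP e1 /dual_colouringP e2.
      by rewrite e1 // e2 // predE (neqK u uk) (neqK v vk); case: (separates _ _ _).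
    - move=> /dual_colouringP e1 /dual_colouringP e2.
      by rewrite e1 // e2 // predE (neqK u uk) (neqK v vk); case: (separates _ _ _).
  apply/dual_colouringP => u v /eqP; rewrite isolate_colouringP.
  case: (u =P k) => [->|uk] /=; case: (v =P k) => [->|vk] //=.
    by rewrite !separatesxx.
  by move/eqP; apply: h.
apply/merge_colouringP.
have {}h (u v : 'I_n) : u <> k -> v <> k -> c u = c v -> separates a u v = separates b u v.
  by move=> *; apply: h; apply: isoP.
have [|nab] := eqVneq (dual_colouring c a) (dual_colouring c b); first by apply: Or31.
(* One agreement on a pair k, z extends through z to all pairs of k, and then a and b would already
   be equivalent. *)
have sep (z : 'I_n) : c z = c k -> z <> k -> separates a k z <> separates b k z.
  move=> cz zk; apply/eqP; apply: contra nab => /eqP e; apply/eqP/dual_colouringP => u v cuv.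
  have key (w : 'I_n) : w <> k -> c w = c k -> separates a k w = separates b k w.
    move=> wk cw; rewrite (separates_trans z a) (separates_trans z b) e.
    by rewrite (h z w) // cz cw.
  have [uk|/eqP uk] := eqVneq u k; have [vk|/eqP vk] := eqVneq v k.
  - by rewrite uk vk !separatesxx.
  - by rewrite uk; apply: key => //; rewrite -cuv uk.
  - by rewrite vk !(separatesC _ u); apply: key => //; rewrite cuv vk.
  - exact: h.
(* The two tildes next to the bar k. *)
pose t (e : bool) := if e then ord_pred k else k.
have tE e (u v : 'I_n) : separates (t e) u v =
    separates k u v (+) (e && ((u == k) (+) (v == k))).
  by case: e; rewrite /t ?predE // addbF.
(* Pairs inside the block of k decompose through k, so it suffices to compare the pairs starting at
   k and those of the other blocks. *)
have G (w : 'I_n) (e : bool) :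
    (forall v : 'I_n, v <> k -> c v = c k -> separates w k v = separates k k v (+) e) ->
    (forall u v : 'I_n, c u = c v -> c u <> c k -> separates w u v = separates k u v) ->
    dual_colouring c w = dual_colouring c (t e).
  move=> h1 h2; apply/dual_colouringP => u v cuv; rewrite tE.
  have [cu|/eqP cu] := eqVneq (c u) (c k); last first.
    rewrite !neqK ?andbF ?addbF; first exact: h2.
      by move=> e'; case: cu; rewrite cuv e'.
    by move=> e'; case: cu; rewrite e'.
  have h1' (x : 'I_n) : c x = c k ->
      separates w k x = separates k k x (+) (e && (x != k)).
    move=> cx; have [->|/eqP xk] := eqVneq x k; first by rewrite !separatesxx andbF.
    by rewrite andbT; apply: h1.
  rewrite (separates_trans k w) (separates_trans k k u v) !(separatesC _ u k).
  rewrite (h1' u cu) (h1' v) -?cuv //.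
  by case: (separates k k u); case: (separates k k v); case: (u == k);
    case: (v == k); case: e {h1 h1'}.
(* The tildes x and y differ exactly where the two neighbours of k do: when x is equivalent to one
   neighbour, y is equivalent to the other. *)
have flip (x y : 'I_n) (e : bool) :
    (forall z : 'I_n, c z = c k -> z <> k -> separates x k z <> separates y k z) ->
    (forall u v : 'I_n, u <> k -> v <> k -> c u = c v -> separates x u v = separates y u v) ->
    dual_colouring c x = dual_colouring c (t e) ->
    dual_colouring c y = dual_colouring c (t (~~ e)).
  move=> hs hh /dual_colouringP xe; apply: G => [v vk cv|u v cuv cu].
    have := hs v cv vk; rewrite xe ?cv // tE eqxx neqK //= andbT.
    by case: (separates k k v); case: (separates y k v); case: (e).
  have uk : u <> k by move=> e'; case: cu; rewrite e'.
  have vk : v <> k by move=> e'; case: cu; rewrite cuv e'.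
  by rewrite -hh // xe // tE !neqK // andbF addbF.
have z0k' : z0 <> k :> nat by move/val_inj.
(* Depending on the position of k relative to a and b, one of them can be
   joined to a neighbour of k without meeting any block. *)
have W (x y : 'I_n) (e : bool) :
    (forall z : 'I_n, c z = c k -> z <> k -> separates x k z <> separates y k z) ->
    (forall u v : 'I_n, u <> k -> v <> k -> c u = c v -> separates x u v = separates y u v) ->
    (if e then (x < k) && ((y <= x) || (k <= y)) else k <= x <= y)%N ->
    exists e', dual_colouring c x = dual_colouring c (t e').
  move=> hs hh he; exists e; apply: G => [v vk cv|u v cuv cu].
    have vk' : v <> k :> nat by move/val_inj.
    by move: he (hs v cv vk); rewrite /separates; case: (e); lia.
  have cv : c v <> c k by rewrite -cuv.
  have uk : u <> k by move=> e'; case: cu; rewrite e'.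
  have vk : v <> k by move=> e'; case: cv; rewrite e'.
  have [f1 f2] : u <> z0 :> nat /\ v <> z0 :> nat by split; apply: neq; rewrite cz0.
  have [f3 f4] : u <> k :> nat /\ v <> k :> nat by split; apply: neq.
  move: he (hh u v uk vk cuv) (hs z0 cz0 z0k) (nc u v k z0 cuv (esym cz0) cu).
  by rewrite /separates; case: (e); lia.
have hs (z : 'I_n) : c z = c k -> z <> k -> separates b k z <> separates a k z.
  by move=> cz zk /esym; apply: sep.
have hh (u v : 'I_n) : u <> k -> v <> k -> c u = c v -> separates b u v = separates a u v.
  by move=> *; apply/esym/h.
have [xe|xe] : (exists e, dual_colouring c a = dual_colouring c (t e)) \/
               (exists e, dual_colouring c b = dual_colouring c (t e)).
  have [kb|kb] := leqP k b; have [ka|ka] := leqP k a; have [ab|ab] := leqP a b;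
  first [ left; apply: (W a b false) => //; lia | left; apply: (W a b true) => //; lia
        | right; apply: (W b a false) => //; lia | right; apply: (W b a true) => //; lia ].
- case: xe => e xe; have := flip a b e sep h xe; move: xe.
  by case: e => xe ye; [apply: Or33|apply: Or32].
case: xe => e xe; have := flip b a e hs hh xe; move: xe.
by case: e => xe ye; [apply: Or32|apply: Or33].
Qed.

End Isolation.

(** * Reordering wedges of basis vectors *)

Section WedgeDelta.
Variables (R : fieldType) (k m : nat).

Definition wedge_delta (g : 'I_k -> 'I_m) : extpow k 'rV[R]_m :=
  wedge [ffun a => delta_mx 0 (g a)].

Lemma eq_wedge_delta g h : g =1 h -> wedge_delta g = wedge_delta h.
Proof. by move=> e; congr wedge; apply/ffunP => a; rewrite !ffunE e. Qed.

Lemma wedge_delta_eq0 g p q : p != q -> g p = g q -> wedge_delta g = 0.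
Proof. by move=> pq e; apply: (wedge_alternating pq); rewrite !ffunE e. Qed.

Lemma wedge_perm (W : vectType R) (s : {perm 'I_k}) (x : {ffun 'I_k -> W}) :
  wedge [ffun a => x (s a)] = (-1) ^+ s *: wedge x.
Proof.
apply/ffunP => I; rewrite !ffunE -det_perm.
rewrite -[RHS]det_mulmx -row_permE; congr (\det _).
by apply/matrixP => a b; rewrite !mxE ffunE.
Qed.

Lemma increasing_inj (g : 'I_k -> 'I_m) :
  {homo g : a b / (a < b)%N} -> injective g.
Proof.
move=> hg a b e; apply/val_inj; case: (ltngtP a b) => // /hg;
by rewrite e ltnn.
Qed.

Lemma increasing_rank (K : ksub k m) (g : 'I_k -> 'I_m) a :
  {homo g : a b / (a < b)%N} -> (forall a, g a \in val K) ->
  #|[set y in val K | (y < g a)%N]| = a.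
Proof.
move=> hg gK; have ginj := increasing_inj hg.
have KE : val K = g @: [set: 'I_k].
  apply/esym/eqP; rewrite eqEcard card_imset // cardsT card_ord (eqP (valP K)) leqnn andbT.
  by apply/subsetP => _ /imsetP[b _ ->].
have -> : [set y in val K | (y < g a)%N] = g @: [set b : 'I_k | (b < a)%N].
  apply/setP => y; rewrite inE KE; apply/andP/imsetP => [[/imsetP[b _ ->] lt]|[b]].
    exists b => //; rewrite inE; case: (ltngtP b a) lt => // [/hg|/val_inj ->].
      by move=> h1 h2; have := ltn_trans h1 h2; rewrite ltnn.
    by rewrite ltnn.
  by rewrite inE => ba ->; split; [apply: imset_f|apply: hg].
rewrite card_imset // -sum1_card; under eq_bigl => b do rewrite inE.
by rewrite -(big_ord_widen k (fun=> 1%N)) ?sum1_card ?card_ord // ltnW.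
Qed.

(** In an increasing enumeration the position of an element is the number of smaller elements, which
    depends on the set only. *)
Lemma increasing_kelt (K : ksub k m) (g : 'I_k -> 'I_m) :
  {homo g : a b / (a < b)%N} -> (forall a, g a \in val K) -> g =1 kelt K.
Proof.
move=> hg gK a; have /keltP[b e] := gK a; rewrite e; congr kelt; apply: val_inj.
have hk : {homo kelt K : a b / (a < b)%N} by move=> ? ?; apply: kelt_mono.
have kK c : kelt K c \in val K by apply/keltP; exists c.
by rewrite /= -(increasing_rank b hk kK) -e increasing_rank.
Qed.

Lemma wedge_delta_sort (K : ksub k m) (g : 'I_k -> 'I_m) (s : {perm 'I_k}) :
  {homo g \o s : a b / (a < b)%N} -> (forall a, g a \in val K) ->
  wedge_delta g = (-1) ^+ s *: wedge_delta (kelt K).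
Proof.
move=> hg gK; rewrite -(eq_wedge_delta (increasing_kelt hg (fun a => gK _))).
have -> : wedge_delta (g \o s) = (-1) ^+ s *: wedge_delta g.
  rewrite /wedge_delta -wedge_perm; congr wedge; apply/ffunP => a.
  by rewrite !ffunE.
by rewrite scalerA -signr_addb addbb scale1r.
Qed.

End WedgeDelta.

(** * Signs when one index of a basis wedge is replaced *)

Section SwapKelt.
Variables (R : fieldType) (k m : nat).
Implicit Types (I K : ksub k m) (j : 'I_k).

Lemma kelt_lt I a b : (kelt I a < kelt I b)%N = (a < b)%N.
Proof.
case: (ltngtP a b) => [/(kelt_mono I) //|/(kelt_mono I)|/val_inj ->].
  by move=> h; apply/negbTE; rewrite -leqNgt ltnW.
by rewrite ltnn.
Qed.

Definition swap_kelt I j (s : 'I_m) (a : 'I_k) := if a == j then s else kelt I a.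

Lemma swap_kelt_in I j s K : val K = s |: val I :\ kelt I j ->
  forall a, swap_kelt I j s a \in val K.
Proof.
move=> -> a; rewrite /swap_kelt !inE; case: (eqVneq a j) => [_|aj].
  by rewrite eqxx.
rewrite (inj_eq (@kelt_inj _ _ I)) aj /=; apply/orP; right.
by apply/keltP; exists a.
Qed.

(** No index lies strictly between two consecutive integers, so the family stays increasing and no
    sign appears. *)
Lemma wedge_swap_adjacent I j (s : 'I_m) K : s \notin val I ->
  val K = s |: val I :\ kelt I j ->
  (s == (kelt I j).+1 :> nat) || (s.+1 == kelt I j :> nat) ->
  wedge_delta R (swap_kelt I j s) = wedge_delta R (kelt K).
Proof.
move=> sI /swap_kelt_in inK adj.
rewrite (@wedge_delta_sort _ _ _ K _ (1%g)) //.
  by rewrite odd_perm1 expr0 scale1r.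
have sne a : kelt I a <> s :> nat.
  by move=> /val_inj e; case/negP: sI; apply/keltP; exists a.
move=> a b ab /=; rewrite !perm1 /swap_kelt.
have := kelt_mono I ab; have := sne a; have := sne b; move: ab adj.
by have [->|_] := eqVneq a j; have [->|_] := eqVneq b j; lia.
Qed.

End SwapKelt.

(** The new smallest index stands in the last place. Moving it to the front is a cycle of length k,
    of sign (-1)^(k - 1). *)
Lemma wedge_swap_first (R : fieldType) (k m : nat) (I K : ksub k m) (j : 'I_k) (s : 'I_m) :
  val K = s |: val I :\ kelt I j -> (forall a, s < kelt I a)%N ->
  (forall a, kelt I a <= kelt I j)%N ->
  wedge_delta R (swap_kelt I j s) = (-1) ^+ k.-1 *: wedge_delta R (kelt K).
Proof.
case: k I K j => [|k] I K j; first by case: j.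
move=> /swap_kelt_in inK smin jmax.
have jE : j = ord_max.
  apply/val_inj/eqP; rewrite eqn_leq /= -ltnS ltn_ord /=.
  have := jmax ord_max; rewrite leqNgt kelt_lt -leqNgt //.
have swE (a : 'I_k) : swap_kelt I j s (lift ord_max a) = kelt I (lift ord_max a).
  by rewrite /swap_kelt jE eq_sym (negPf (neq_lift _ _)).
rewrite (@wedge_delta_sort _ _ _ K _ (lift_perm ord0 ord_max 1%g)) //.
  by rewrite odd_lift_perm odd_perm1 addbF /= signr_odd.
move=> a b; case: (unliftP ord0 a) => [a'|] -> /=; case: (unliftP ord0 b) => [b'|] -> //= ab;
  rewrite ?lift_perm_lift ?lift_perm_id ?perm1 ?swE.
- by apply: kelt_mono; move: ab; rewrite /= /bump /=; have := ltn_ord a'; have := ltn_ord b'; lia.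
- by rewrite /swap_kelt jE eqxx.
Qed.

Lemma wedge_swap_last (R : fieldType) (k m : nat) (I K : ksub k m) (j : 'I_k) (s : 'I_m) :
  val K = s |: val I :\ kelt I j -> (forall a, kelt I a < s)%N ->
  (forall a, kelt I j <= kelt I a)%N ->
  wedge_delta R (swap_kelt I j s) = (-1) ^+ k.-1 *: wedge_delta R (kelt K).
Proof.
case: k I K j => [|k] I K j; first by case: j.
move=> /swap_kelt_in inK smax jmin.
have jE : j = ord0.
  apply/val_inj/eqP; rewrite -leqn0.
  have := jmin ord0; rewrite leqNgt kelt_lt -leqNgt //.
have swE (a : 'I_k) : swap_kelt I j s (lift ord0 a) = kelt I (lift ord0 a).
  by rewrite /swap_kelt jE eq_sym (negPf (neq_lift _ _)).
rewrite (@wedge_delta_sort _ _ _ K _ (lift_perm ord_max ord0 1%g)) //.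
  by rewrite odd_lift_perm odd_perm1 !addbF /= signr_odd.
move=> a b; case: (unliftP ord_max a) => [a'|] -> /=;
  case: (unliftP ord_max b) => [b'|] -> //= ab;
  rewrite ?lift_perm_lift ?lift_perm_id ?perm1 ?swE.
- by apply: kelt_mono; move: ab; rewrite /= /bump /=; have := ltn_ord a'; have := ltn_ord b'; lia.
- by rewrite /swap_kelt jE eqxx.
- have h : (b' < k)%N := ltn_ord b'.
  by move: ab; rewrite /bump (leqNgt k b') h add0n ltnNge (ltnW h).
- by rewrite ltnn in ab.
Qed.

(** * Action of a generator on a basis wedge *)

Section LamAction.
Variables (R : fieldType) (n : nat).
Implicit Types (I K : ksub n.-1 n.*2) (i : 'I_n.*2) (j : 'I_n.-1).

Lemma ordSE i : ordS i = (if i.+1 == n.*2 then 0 else i.+1)%N :> nat.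
Proof.
rewrite /=; have [->|ne] := eqVneq i.+1 n.*2; first by rewrite modnn.
by rewrite modn_small //; have := ltn_ord i; lia.
Qed.

(** The existence of j gives n at least 2. The right side is the sign of the cycle of length n - 1
    that reorders the indices after a wrap around, so the sign in the generator cancels it. *)
Lemma wrap_sign j : (-1) ^+ n = (-1) ^+ n.-1.-1 :> R.
Proof.
by case: n j => [|[|p]] [] // _ _; rewrite !exprS mulrA mulrNN !mul1r.
Qed.

Lemma wedge_ordS I j K : ordS (kelt I j) \notin val I ->
  val K = ordS (kelt I j) |: val I :\ kelt I j ->
  (if (kelt I j).+1 == n.*2 then (-1) ^+ n else 1) *:
    wedge_delta R (swap_kelt I j (ordS (kelt I j))) = e_ R K.
Proof.
move=> sI eK; have sE := ordSE (kelt I j); move: sE.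
case: eqP => [wrap|nwrap] sE; last first.
  by rewrite scale1r (wedge_swap_adjacent _ sI eK) // sE eqxx.
rewrite (wedge_swap_first _ eK) => [|a|a].
- by rewrite (wrap_sign j) scalerA -expr2 sqrr_sign scale1r.
- rewrite sE lt0n; apply/eqP => e0; case/negP: sI.
  by apply/keltP; exists a; apply/val_inj; rewrite [LHS]sE /= e0.
- by rewrite -ltnS wrap.
Qed.

Lemma wedge_ord_pred I j K : ord_pred (kelt I j) \notin val I ->
  val K = ord_pred (kelt I j) |: val I :\ kelt I j ->
  (if kelt I j == 0%N :> nat then (-1) ^+ n else 1) *:
    wedge_delta R (swap_kelt I j (ord_pred (kelt I j))) = e_ R K.
Proof.
move=> sI eK; have sE := ord_predE (kelt I j); move: sE.
case: eqP => [wrap|nwrap] sE; last first.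
  rewrite scale1r (wedge_swap_adjacent _ sI eK) // sE prednK ?eqxx ?orbT //.
  by rewrite lt0n; apply/eqP.
rewrite (wedge_swap_last _ eK) => [|a|a].
- by rewrite (wrap_sign j) scalerA -expr2 sqrr_sign scale1r.
- have : kelt I a <> ord_pred (kelt I j) :> nat.
    by move/val_inj => e; case/negP: sI; rewrite -e; apply/keltP; exists a.
  by rewrite sE; have := ltn_ord (kelt I a); lia.
- by rewrite wrap.
Qed.

(** Defined on all subsets so that sums can be reindexed by exchanges of elements; sets of the wrong
    size get 0. *)
Definition e_set (A : {set 'I_n.*2}) : extpow n.-1 'rV[R]_n.*2 :=
  if (insub A : option (ksub n.-1 n.*2)) is Some K then e_ R K else 0.

Lemma e_set_val I : e_set (val I) = e_ R I.
Proof. by rewrite /e_set valK. Qed.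

Lemma card_swap (I : {set 'I_n.*2}) i s : i \in I -> s \notin I ->
  #|s |: I :\ i| = #|I|.
Proof.
by move=> iI sI; rewrite cardsU1 !inE (negPf sI) andbF (cardsD1 i I) iI.
Qed.

Lemma delta_lam i (l : 'I_n.*2) : delta_mx 0 l *m lam R i =
  if l == i then (if i.+1 == n.*2 then (-1) ^+ n else 1) *: delta_mx 0 (ordS i)
    + (if i == 0%N :> nat then (-1) ^+ n else 1) *: delta_mx 0 (ord_pred i)
  else 0 :> 'rV[R]_n.*2.
Proof.
have E (j : 'I_n.*2) : delta_mx 0 l *m delta_mx i j =
    (if l == i then delta_mx 0 j else 0) :> 'rV[R]_n.*2.
  by case: eqP => [->|/eqP li]; rewrite ?mul_delta_mx ?mul_delta_mx_0.
by rewrite /lam mulmxDr -!scalemxAr !E; case: (l == i); rewrite ?scaler0 ?addr0.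
Qed.

(** The generator kills every factor except the one of index i, and a neighbour of i that is already
    an index gives a repeated factor. *)
Lemma ext_der_e i I :
  ext_der (mulmxr (lam R i)) (e_ R I) =
  if i \in val I then
    (if ordS i \in val I then 0 else e_set (ordS i |: val I :\ i))
    + (if ord_pred i \in val I then 0 else e_set (ord_pred i |: val I :\ i))
  else 0.
Proof.
have W0 j x : wedge (fupd x j 0) = 0 :> extpow n.-1 'rV[R]_n.*2.
  exact: (mf_zero (@wedge_multilinear R n.-1 'rV[R]_n.*2)).
rewrite /e_ ext_derE; case: ifPn => [/keltP[j iE]|iI]; last first.
  apply: big1 => j _; rewrite /= ffunE delta_lam.
  case: eqP => [e|_]; last exact: W0.
  by case/negP: iI; apply/keltP; exists j.
rewrite (bigD1 j) //= big1 ?addr0; last first.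
  move=> l lj; rewrite ffunE delta_lam iE (inj_eq (@kelt_inj _ _ I)) (negPf lj).
  exact: W0.
rewrite ffunE delta_lam -iE eqxx.
have swE s : wedge (fupd [ffun a => delta_mx 0 (kelt I a)] j (delta_mx 0 s)) =
    wedge_delta R (swap_kelt I j s).
  congr wedge; apply/ffunP => a; rewrite !ffunE /swap_kelt.
  by case: eqP.
have scE x a (y : 'rV[R]_n.*2) : wedge (fupd x j (a *: y)) =
    a *: wedge (fupd x j y) :> extpow n.-1 'rV[R]_n.*2.
  by rewrite -[a *: y]addr0 wedge_multilinear W0 addr0.
have in0 s : s != i -> s \in val I -> wedge_delta R (swap_kelt I j s) = 0.
  move=> si /keltP[b sb]; apply: (@wedge_delta_eq0 _ _ _ _ j b).
    by apply: contra si => /eqP e; rewrite sb iE e.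
  rewrite /swap_kelt eqxx; case: eqP => [e|//]; by rewrite sb e.
have n1 : (1 < n)%N by case: (n) j {iE swE scE in0 W0} => [|[|p]] // [].
have Si : ordS i != i.
  by rewrite -val_eqE; apply/eqP; rewrite [val (ordS i)]ordSE /=; case: eqP; lia.
have Pi : ord_pred i != i.
  by rewrite -val_eqE; apply/eqP; rewrite [val (ord_pred i)]ord_predE /=; case: eqP; lia.
have fin s : s \notin val I -> exists2 K : ksub n.-1 n.*2,
    val K = s |: val I :\ i & e_set (s |: val I :\ i) = e_ R K.
  move=> sI; have h : #|s |: val I :\ i| == n.-1.
    rewrite card_swap ?(eqP (valP I)) //; by apply/keltP; exists j.
  pose K : ksub n.-1 n.*2 := exist (fun A : {set _} => #|A| == n.-1) _ h.
  by exists K => //; apply: (e_set_val K).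
rewrite (mf_add (@wedge_multilinear R n.-1 'rV[R]_n.*2)) !scE !swE.
congr (_ + _).
  have [sI|sI] := boolP (ordS i \in val I); first by rewrite in0 ?scaler0.
  have [K KE ->] := fin _ sI; rewrite iE in sI KE *; exact: wedge_ordS.
have [sI|sI] := boolP (ord_pred i \in val I); first by rewrite in0 ?scaler0.
have [K KE ->] := fin _ sI; rewrite iE in sI KE *; exact: wedge_ord_pred.
Qed.

End LamAction.

(** * Counting concordant sets after an exchange *)

Section ConcordantColourings.
Variable m : nat.
Implicit Types (B : {set 'I_m}) (i s x y : 'I_m).

Definition colour_class (T : eqType) (f : 'I_m -> T) x := [set y | f x == f y].

Definition concordant_colouring (T : eqType) (f : 'I_m -> T) B :=
  [forall x, #|colour_class f x :\: B| == 1%N].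

Lemma eq_colour_class (T : eqType) (f : 'I_m -> T) x y :
  f x = f y -> colour_class f x = colour_class f y.
Proof. by rewrite /colour_class => ->. Qed.

(** Only the classes of i and s are affected. After the exchange i is no longer omitted, and s must
    be the one omitted element of its class, so this class lies inside B; in particular s is in
    B. *)
Lemma concordant_swap (T : eqType) (f : 'I_m -> T) B i s : f i <> f s ->
  [&& s \in B, i \notin B & concordant_colouring f (i |: B :\ s)] =
  [&& i \notin B, #|(colour_class f i :\ i) :\: B| == 1%N,
      #|colour_class f s :\: B| == 0%N &
      [forall x, (f x != f i) ==> (f x != f s) ==> (#|colour_class f x :\: B| == 1%N)]].
Proof.
move=> fis; have si : s != i by apply/eqP => e; apply: fis; rewrite e.
case iB : (i \in B); rewrite ?andbF //=.
have Ei : (colour_class f i :\ i) :\: B = colour_class f i :\: (i |: B :\ s).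
  apply/setP => y; rewrite !inE; case: (eqVneq y s) => [->|_] /=.
    by rewrite (introF eqP fis) !andbF.
  by case: (eqVneq y i) => [->|] //=; rewrite ?andbF.
have Ex x : f x != f i -> f x != f s ->
    colour_class f x :\: (i |: B :\ s) = colour_class f x :\: B.
  move=> xi xs; apply/setP => y; rewrite !inE.
  case: (eqVneq y s) => [->|_] /=; first by rewrite (negPf xs) !andbF.
  by case: (eqVneq y i) => [->|] //=; rewrite (negPf xi) !andbF.
have Es : s \in B -> #|colour_class f s :\: (i |: B :\ s)| = #|colour_class f s :\: B|.+1.
  move=> sB; rewrite (cardsD1 s) !inE !eqxx (negPf si) /= add1n; congr (_.+1).
  apply: eq_card => y; rewrite !inE.
  case: (eqVneq y s) => [->|_] /=; first by rewrite sB.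
  case: (eqVneq y i) => [->|] //=; rewrite [f s == f i]eq_sym.
  by rewrite (introF eqP fis) !andbF.
have s0 : #|colour_class f s :\: B| == 0%N -> s \in B.
  rewrite cards_eq0 => /eqP/setP/(_ s); rewrite !inE eqxx andbT.
  by move/negbFE.
apply/andP/and3P => [[sB /forallP h]|[hi hs /forallP h]].
  split.
  - by rewrite Ei.
  - by have := h s; rewrite Es.
  - apply/forallP => x; apply/implyP => xi; apply/implyP => xs.
    by have := h x; rewrite Ex.
have sB := s0 hs; split=> //; apply/forallP => x.
have [e|xi] := eqVneq (f x) (f i); first by rewrite (eq_colour_class e) -Ei.
have [e|xs] := eqVneq (f x) (f s); first by rewrite (eq_colour_class e) Es // (eqP hs).
by rewrite Ex //; have := h x; rewrite xi xs.
Qed.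

(** The classes of g are the singleton of i, the class of i without i, which contains z, the union
    of the classes of s and t, and the other classes of f. *)
Lemma concordant_isolate_merge (T U : eqType) (f : 'I_m -> T) (g : 'I_m -> U) B i s t z :
  f i <> f s -> f i <> f t -> f s <> f t -> f z = f i -> z != i ->
  (forall x y, (g x == g y) =
    (isolate_colouring i (merge_colouring s t f) x ==
     isolate_colouring i (merge_colouring s t f) y)) ->
  concordant_colouring g B =
  [&& i \notin B, #|(colour_class f i :\ i) :\: B| == 1%N,
      (#|colour_class f s :\: B| + #|colour_class f t :\: B| == 1)%N &
      [forall x, (f x != f i) ==> (f x != f s) ==> (f x != f t) ==>
                   (#|colour_class f x :\: B| == 1%N)]].
Proof.
move=> fis fit fst fzi zi gE.
have Ci : colour_class g i = [set i].
  apply/setP => y; rewrite !inE gE isolate_colouringP eqxx /= andbT.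
  by case: (y == i).
have gE' x y : x != i -> (y \in colour_class g x) =
    (y != i) && (merge_colouring s t f x == merge_colouring s t f y).
  by move=> xi; rewrite inE gE isolate_colouringP (negPf xi) /=; case: (y == i).
have Cz x : x != i -> f x = f i -> colour_class g x = colour_class f i :\ i.
  move=> xi fx; apply/setP => y; rewrite gE' // !inE /merge_colouring fx.
  rewrite (introF eqP fit); case: (y == i) => //=.
  by case: (eqVneq (f y) (f t)) => [->|//]; rewrite (introF eqP fis) (introF eqP fit).
have Cst x : (f x == f s) || (f x == f t) ->
    colour_class g x = colour_class f s :|: colour_class f t.
  move=> h; have xi : x != i.
    by apply: contraL h => /eqP ->; rewrite (introF eqP fis) (introF eqP fit).
  have mx : merge_colouring s t f x = f s.
    by rewrite /merge_colouring; case: (eqVneq (f x) (f t)) h; rewrite ?orbF // => _ /eqP.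
  apply/setP => y; rewrite gE' // mx !inE /merge_colouring.
  rewrite ![_ == f y]eq_sym; case: (eqVneq (f y) (f t)) => [e|ne].
    rewrite eqxx orbT andbT; apply/eqP => ei; apply: fit; by rewrite -e ei.
  rewrite orbF [f s == _]eq_sym; case: (eqVneq (f y) (f s)) => [e|_]; rewrite ?andbF // andbT.
  by apply/eqP => ei; apply: fis; rewrite -e ei.
have Cx x : f x != f i -> f x != f s -> f x != f t -> colour_class g x = colour_class f x.
  move=> xi xs xt; have xi' : x != i by apply: contra xi => /eqP ->.
  apply/setP => y; rewrite gE' // inE /merge_colouring (negPf xt).
  case: (eqVneq (f y) (f t)) => [->|_].
    by rewrite (negPf xs) (negPf xt) andbF.
  by case: eqVneq => //= e; case: (f x =P f y) => // e'; rewrite e' e eqxx in xi.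
have cst : #|(colour_class f s :|: colour_class f t) :\: B| =
    (#|colour_class f s :\: B| + #|colour_class f t :\: B|)%N.
  rewrite setDUl cardsU; have -> : (colour_class f s :\: B) :&: (colour_class f t :\: B) = set0.
    apply/setP => y; rewrite !inE; apply/negP => /andP[/andP[_ /eqP h1] /andP[_ /eqP h2]].
    by apply: fst; rewrite h1 h2.
  by rewrite cards0 subn0.
have ci : (#|[set i] :\: B| == 1%N) = (i \notin B).
  case iB : (i \in B).
    have -> : [set i] :\: B = set0 by apply/eqP; rewrite setD_eq0 sub1set iB.
    by rewrite cards0.
  have -> : [set i] :\: B = [set i] by apply/setDidPl; rewrite disjoints1 iB.
  by rewrite cards1.
apply/forallP/and4P => [h|[hi hA hst /forallP h] x].
  split.
  - by have := h i; rewrite Ci ci.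
  - by have := h z; rewrite Cz.
  - by have := h s; rewrite Cst ?eqxx // cst.
  - apply/forallP => x; apply/implyP => xi; apply/implyP => xs; apply/implyP => xt.
    by have := h x; rewrite Cx.
have [->|xi] := eqVneq x i; first by rewrite Ci ci.
have [fxi|fxi] := eqVneq (f x) (f i); first by rewrite Cz.
have [fxst|] := boolP ((f x == f s) || (f x == f t)); first by rewrite Cst // cst.
rewrite negb_or => /andP[xs xt]; have := h x; rewrite fxi xs xt /=.
by rewrite Cx.
Qed.

(** A concordant B omits one element of the merged class, which lies in the class of s or in that of
    t. By [concordant_swap] the exchange works exactly for the point whose class lies inside B. *)
Lemma concordant_sum (T U : eqType) (f : 'I_m -> T) (g : 'I_m -> U) B i s t z :
  f i <> f s -> f i <> f t -> f s <> f t -> f z = f i -> z != i ->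
  (forall x y, (g x == g y) =
    (isolate_colouring i (merge_colouring s t f) x ==
     isolate_colouring i (merge_colouring s t f) y)) ->
  ([&& s \in B, i \notin B & concordant_colouring f (i |: B :\ s)]
   + [&& t \in B, i \notin B & concordant_colouring f (i |: B :\ t)]
   = concordant_colouring g B)%N.
Proof.
move=> fis fit fst fzi zi gE.
rewrite !concordant_swap // (concordant_isolate_merge B fis fit fst fzi zi gE).
set o := [forall x, _ ==> _ ==> _ ==> _].
have E (u v : 'I_m) : f i <> f v -> f u <> f v ->
  [forall x, (f x != f i) ==> (f x != f u) ==> (#|colour_class f x :\: B| == 1%N)] =
  (#|colour_class f v :\: B| == 1%N) &&
  [forall x, (f x != f i) ==> (f x != f u) ==> (f x != f v) ==>
    (#|colour_class f x :\: B| == 1%N)].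
  move=> iv uv; apply/forallP/andP => [h|[hv /forallP h] x].
    split; last first.
      apply/forallP => x; have := h x; case: (f x != f i) => //=.
      by case: (f x != f u) => //= ->; apply: implybT.
    by have := h v; rewrite ![f v == _]eq_sym (introF eqP iv) (introF eqP uv).
  have := h x; case: (eqVneq (f x) (f v)) => [e|//].
  by rewrite (eq_colour_class e) hv !implybT.
rewrite (E s t) // (E t s) //; last by move/esym.
have -> : [forall x, (f x != f i) ==> (f x != f t) ==> (f x != f s) ==>
    (#|colour_class f x :\: B| == 1%N)] = o.
  by apply: eq_forallb => x; case: eqP; case: eqP; case: eqP.
rewrite -/o; case: (i \notin B) => //=; case: (_ == 1%N) => //=.
case: #|colour_class f s :\: B| => [|[|a]]; case: #|colour_class f t :\: B| => [|[|b]];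
  case: o => //=; by rewrite ?addnS.
Qed.

End ConcordantColourings.

(** * Action of a generator on the sum over concordant sets *)

Section StepAction.
Variables (R : fieldType) (n : nat).
Implicit Types (i : 'I_n.*2) (A B : {set 'I_n.*2}).

Definition w_colouring (T : eqType) (f : 'I_n.*2 -> T) : extpow n.-1 'rV[R]_n.*2 :=
  \sum_(A : {set 'I_n.*2} | (#|A| == n.-1) && concordant_colouring f A) e_set R A.

Lemma concordant_fibres (T : eqType) (c : 'I_n -> T) A : nc_colouring c ->
  concordant (fibres c) A = (#|A| == n.-1) && concordant_colouring (full_colouring c) A.
Proof.
move=> nc; rewrite /concordant full_partition_fibres //; congr (_ && _).
apply/forall_inP/forallP => [h x|h B /fibresP[x ->]]; last exact: h.
by apply: h; apply: mem_fibres.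
Qed.

Lemma w_fibres (T : eqType) (c : 'I_n -> T) : nc_colouring c ->
  w_ R (fibres c) = w_colouring (full_colouring c).
Proof.
move=> nc; rewrite /w_ /w_colouring.
rewrite [RHS](eq_bigl (fun A => (A \in (fun A => #|A| == n.-1)) && concordant (fibres c) A)).
  rewrite (big_sub_cond (fun A : {set 'I_n.*2} => #|A| == n.-1)).
  by apply: eq_bigr => K _; rewrite -[LHS]e_set_val.
move=> A; rewrite concordant_fibres // unfold_in /=.
by case: (#|A| == n.-1).
Qed.

Lemma ext_der_sum (k : nat) (W : vectType R) (u : {linear W -> W}) (I : finType)
    (P : pred I) (F : I -> extpow k W) :
  ext_der u (\sum_(j | P j) F j) = \sum_(j | P j) ext_der u (F j).
Proof.
have lin := ext_lift_linear (fun x : {ffun 'I_k -> W} => \sum_j wedge (fupd x j (u (x j)))).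
apply: (big_morph (ext_der u)) => [v w|].
  by have := lin 1 v w; rewrite !scale1r.
by have := lin (-1) 0 0; rewrite scaler0 addr0 scaleN1r addNr.
Qed.

Lemma ext_der_e_set i A : #|A| == n.-1 ->
  ext_der (mulmxr (lam R i)) (e_set R A) =
  (if (i \in A) && (ordS i \notin A) then e_set R (ordS i |: A :\ i) else 0)
  + (if (i \in A) && (ord_pred i \notin A) then e_set R (ord_pred i |: A :\ i) else 0).
Proof.
move=> hA; pose K : ksub n.-1 n.*2 := exist (fun A : {set _} => #|A| == n.-1) A hA.
rewrite -[A]/(val K) e_set_val ext_der_e.
case: (i \in val K); last by rewrite addr0.
by case: (ordS i \in val K); case: (ord_pred i \in val K).
Qed.

(** The exchange is a bijection from the sets with i and without s to those with s and without i,
    and it preserves the size. The new index B is the set whose wedge is produced. *)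
Lemma sum_swap (P : pred {set 'I_n.*2}) (i s : 'I_n.*2) : s != i ->
  \sum_(A : {set 'I_n.*2} | (#|A| == n.-1) && P A)
     (if (i \in A) && (s \notin A) then e_set R (s |: A :\ i) else 0) =
  \sum_(B : {set 'I_n.*2} | #|B| == n.-1)
     (if [&& s \in B, i \notin B & P (i |: B :\ s)] then e_set R B else 0).
Proof.
move=> si; rewrite -!big_mkcondr.
have K (u v : 'I_n.*2) A : u \in A -> v \notin A -> u |: (v |: A :\ u) :\ v = A.
  move=> uA vA; apply/setP => y; rewrite !inE.
  case: (eqVneq y u) => [->|_] //=; case: (eqVneq y v) => [->|_] //=.
  by rewrite (negPf vA).
rewrite (reindex_onto (fun B => i |: B :\ s) (fun A => s |: A :\ i)); last first.
  by move=> A /and3P[_ iA sA]; apply: K.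
have cond (B : {set 'I_n.*2}) :
    ((#|i |: B :\ s| == n.-1) && P (i |: B :\ s)
     && ((i \in i |: B :\ s) && (s \notin i |: B :\ s))
     && (s |: (i |: B :\ s) :\ i == B)) =
    (#|B| == n.-1) && [&& s \in B, i \notin B & P (i |: B :\ s)].
  have [/andP[sB iB]|nB] := boolP ((s \in B) && (i \notin B)).
    rewrite card_swap // K // !inE !eqxx (negPf si) sB iB /=.
    by rewrite !andbT.
  transitivity false; last first.
    by apply/esym/negP => /and4P[_ sB iB _]; case/negP: nB; rewrite sB.
  apply/negP => /andP[_ /eqP e]; case/negP: nB; rewrite -e !inE !eqxx.
  by rewrite [i == s]eq_sym (negPf si).
rewrite (eq_bigl _ _ cond); apply: eq_bigr => B /and4P[_ sB iB _].
by rewrite K.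
Qed.

(** Stated for colourings of the whole circle, so that it serves bars and tildes alike. After
    [sum_swap] both sides are sums over B, and [concordant_sum] compares the coefficients. *)
Lemma step_action (T U : eqType) (f : 'I_n.*2 -> T) (g : 'I_n.*2 -> U) (i z : 'I_n.*2) :
  f i <> f (ordS i) -> f i <> f (ord_pred i) -> f (ordS i) <> f (ord_pred i) ->
  f z = f i -> z != i ->
  (forall x y, (g x == g y) =
    (isolate_colouring i (merge_colouring (ordS i) (ord_pred i) f) x ==
     isolate_colouring i (merge_colouring (ordS i) (ord_pred i) f) y)) ->
  ext_der (mulmxr (lam R i)) (w_colouring f) = w_colouring g.
Proof.
move=> fis fit fst fzi zi gE; rewrite /w_colouring ext_der_sum.
have Si : ordS i != i by apply/eqP => e; apply: fis; rewrite e.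
have Pi : ord_pred i != i by apply/eqP => e; apply: fit; rewrite e.
under eq_bigr => A /andP[cA _] do rewrite ext_der_e_set //.
rewrite big_split /= !sum_swap // big_mkcondr -big_split /=.
apply: eq_bigr => B _; have := concordant_sum B fis fit fst fzi zi gE.
by do 2!case: ([&& _, _ & _]); case: (concordant_colouring g B) => //=;
  rewrite ?addr0 ?add0r.
Qed.

(** A concordant set omits the only element i of its class, so the generator kills each term. *)
Lemma step_singleton (T : eqType) (f : 'I_n.*2 -> T) (i : 'I_n.*2) :
  (forall j, f i = f j -> j = i) ->
  ext_der (mulmxr (lam R i)) (w_colouring f) = 0.
Proof.
move=> fi; rewrite /w_colouring ext_der_sum big1 // => A /andP[cA /forallP/(_ i) hA].
have iA : i \notin A.
  apply: contraL hA => iA; have -> : colour_class f i :\: A = set0.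
    by apply/setP => y; rewrite !inE; apply/negP => /andP[yA /eqP/fi e]; rewrite e iA in yA.
  by rewrite cards0.
by rewrite ext_der_e_set // (negPf iA) addr0.
Qed.

End StepAction.

(** * Isolation of a bar and of a tilde *)

Section Steps.
Variables (R : fieldType) (n : nat).

Lemma ordS_bar (k : 'I_n) : ordS (bar k) = tilde k.
Proof.
apply: val_inj; rewrite [LHS]ordSE /=; have := ltn_ord k.
by case: eqP; lia.
Qed.

Lemma ord_pred_tilde (k : 'I_n) : ord_pred (tilde k) = bar k.
Proof. by rewrite -ordS_bar ordSK. Qed.

Lemma ordS_tilde (k : 'I_n) : ordS (tilde k) = bar (ordS k).
Proof.
apply: val_inj; rewrite [LHS]ordSE [RHS]/=; have := ltn_ord k => kn.
have [e|ne] := eqVneq k.+1 n; first by rewrite e modnn /=; case: eqP; lia.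
by rewrite modn_small /=; [case: eqP; lia|lia].
Qed.

Lemma ord_pred_bar (k : 'I_n) : ord_pred (bar k) = tilde (ord_pred k).
Proof. by rewrite -{1}[k]ord_predK -ordS_tilde ordSK. Qed.

Lemma bar_action (T : eqType) (c : 'I_n -> T) (k z : 'I_n) :
  nc_colouring c -> c z = c k -> z != k ->
  ext_der (mulmxr (lam R (bar k))) (w_ R (fibres c)) =
  w_ R (fibres (isolate_colouring k c)).
Proof.
move=> nc czk zk; rewrite !w_fibres //; last exact: nc_isolate.
apply: (@step_action _ _ _ _ _ _ _ (bar z));
  rewrite ?ordS_bar ?ord_pred_bar /full_colouring ?mix_bar ?mix_tilde ?czk //.
(* The two neighbouring tildes disagree on the equivalent pair z, k, so they lie in different dual
   blocks. *)
- case=> /dual_colouringP/(_ _ _ (esym czk)) e.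
  by have := separates_ord_pred k z k; rewrite e addbb eqxx (negPf zk).
- by rewrite (inj_eq (@bar_inj n)).
have mb x : merge_colouring (tilde k) (tilde (ord_pred k))
    (mix_colouring c (dual_colouring c)) (bar x) = inl (c x).
  by rewrite /merge_colouring mix_bar mix_tilde.
have mt x : merge_colouring (tilde k) (tilde (ord_pred k))
    (mix_colouring c (dual_colouring c)) (tilde x) =
    inr (merge_colouring k (ord_pred k) (dual_colouring c) x).
  by rewrite /merge_colouring !mix_tilde -(inj_eq (@inr_inj T _)) (fun_if inr).
move=> x y; rewrite isolate_colouringP.
case: (bar_tildeP x) => {}x; case: (bar_tildeP y) => {}y;
  rewrite ?mb ?mt ?mix_bar ?mix_tilde ?(inj_eq (@bar_inj n)) ?[tilde _ == bar _]eq_sym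
    ?bar_neq_tilde.
- by rewrite -[RHS](isolate_colouringP k c).
- by case: (x == k).
- by case: (y == k).
- exact: (dual_isolate nc czk (elimN eqP zk)).
Qed.

(** If k and [ordS k] were equivalent, this pair would split the tilde k from every other tilde. *)
Lemma dual_neighbour_neq (T : eqType) (c : 'I_n -> T) (k z : 'I_n) :
  dual_colouring c z = dual_colouring c k -> z != k -> c k <> c (ordS k).
Proof.
move=> /dual_colouringP e zk ck; have := separates_ordS z k k.
by rewrite e // addbb eqxx (negPf zk).
Qed.

Lemma tilde_action (T : eqType) (c : 'I_n -> T) (k z : 'I_n) :
  nc_colouring c -> dual_colouring c z = dual_colouring c k -> z != k ->
  ext_der (mulmxr (lam R (tilde k))) (w_ R (fibres c)) =
  w_ R (fibres (merge_colouring k (ordS k) c)).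
Proof.
move=> nc dzk zk; have ck := dual_neighbour_neq dzk zk.
rewrite !w_fibres //; last exact: nc_merge.
apply: (@step_action _ _ _ _ _ _ _ (tilde z));
  rewrite ?ordS_tilde ?ord_pred_tilde /full_colouring ?mix_bar ?mix_tilde ?dzk //.
- by case=> /esym.
- by rewrite (inj_eq (@tilde_inj n)).
have mt x : merge_colouring (bar (ordS k)) (bar k)
    (mix_colouring c (dual_colouring c)) (tilde x) = inr (dual_colouring c x).
  by rewrite /merge_colouring mix_bar mix_tilde.
have mb x : merge_colouring (bar (ordS k)) (bar k)
    (mix_colouring c (dual_colouring c)) (bar x) = inl (merge_colouring (ordS k) k c x).
  by rewrite /merge_colouring !mix_bar (fun_if inl).
move=> x y; rewrite isolate_colouringP.
case: (bar_tildeP x) => {}x; case: (bar_tildeP y) => {}y;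
  rewrite ?mb ?mt ?mix_bar ?mix_tilde ?(inj_eq (@tilde_inj n)) ?bar_neq_tilde //.
(* The two bars are merged in the opposite order to that of [nc_merge], which gives the same
   equivalence. *)
- apply/eqP/eqP => -[/merge_colouringP h]; congr inl; apply/merge_colouringP.
    by case: h => [h|[h1 h2]|[h1 h2]]; [apply: Or31|apply: Or33|apply: Or32].
  by case: h => [h|[h1 h2]|[h1 h2]]; [apply: Or31|apply: Or33|apply: Or32].
- by case: (y == k).
- by case: (x == k).
have := dual_merge c k x y; rewrite isolate_colouringP => <-.
by [].
Qed.

End Steps.

(** * The exterior power of V inside the ambient one *)

Section ExteriorSubspace.
Variables (R : fieldType) (n : nat).

Definition in_ext_lamV (w : extpow n.-1 'rV[R]_n.*2) :=
  exists w' : extpow n.-1 (subvs_of (lamV R n)), ext_map vsval w' = w.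

(** Both sides are linear in w, so wedges suffice; there [lam_resE] applies factor by factor. *)
Lemma ext_der_vsval (i : 'I_n.*2) (w : extpow n.-1 (subvs_of (lamV R n))) :
  ext_der (mulmxr (lam R i)) (ext_map vsval w) = ext_map vsval (ext_der (lam_res R i) w).
Proof.
move: w; apply: ext_lift_unique => [a v w|a v w|x].
- by rewrite /ext_map /ext_der !ext_lift_linear.
- by rewrite /ext_map /ext_der !ext_lift_linear.
rewrite ext_mapE !ext_derE.
have -> : ext_map vsval (\sum_(j < n.-1) wedge (fupd x j (lam_res R i (x j)))) =
    \sum_(j < n.-1) ext_map vsval (wedge (fupd x j (lam_res R i (x j)))).
  have lin := ext_lift_linear
    (fun x : {ffun 'I_n.-1 -> subvs_of (lamV R n)} => wedge [ffun a => vsval (x a)]).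
  apply: (big_morph (ext_map vsval)) => [v w|].
    by have := lin 1 v w; rewrite !scale1r.
  by have := lin (-1) 0 0; rewrite scaler0 addr0 scaleN1r addNr.
apply: eq_bigr => j _; rewrite ext_mapE; congr wedge; apply/ffunP => a.
rewrite !ffunE; case: eqP => // _; exact: esym (lam_resE _ _).
Qed.

Lemma in_ext_lamV_der i w :
  in_ext_lamV w -> in_ext_lamV (ext_der (mulmxr (lam R i)) w).
Proof. by case=> w' <-; exists (ext_der (lam_res R i) w'); rewrite ext_der_vsval. Qed.

Lemma in_ext_lamV_wedge (x : {ffun 'I_n.-1 -> 'rV[R]_n.*2}) :
  (forall a, x a \in lamV R n) -> in_ext_lamV (wedge x).
Proof.
move=> xV; exists (wedge [ffun a => vsproj (lamV R n) (x a)]).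
by rewrite ext_mapE; congr wedge; apply/ffunP => a; rewrite !ffunE; apply: vsprojK.
Qed.

End ExteriorSubspace.



(** * The one-block partition *)

Section BaseCase.
Variables (R : fieldType) (p : nat).

Let E (j : nat) : 'rV[R]_p.+1.*2 := delta_mx 0 (bar (inord j : 'I_p.+1)).

(** Interpolates between [fam p p], made of the vectors E a + E (a + 1), and [fam q 0], which lists
    all bars but q. *)
Let fam (m l : nat) : {ffun 'I_p -> 'rV[R]_p.+1.*2} :=
  [ffun a : 'I_p => if (a < l)%N then E a + E a.+1 else if (a < m)%N then E a else E a.+1].

Let wedgeD (x : {ffun 'I_p -> 'rV[R]_p.+1.*2}) j y z :
  wedge (fupd x j (y + z)) = wedge (fupd x j y) + wedge (fupd x j z).
Proof. exact: (mf_add (@wedge_multilinear R p _)). Qed.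

(** In the sum at place l, the summand E (l + 1) repeats the vector at place l + 1 and contributes
    0. *)
Lemma wedge_fam_left m l : (l < m)%N -> (m <= p)%N -> wedge (fam m l) = wedge (fam m 0).
Proof.
move=> lm mp; elim: l lm => [//|l IH] lm.
have lp : (l < p)%N by lia.
have l1p : (l.+1 < p)%N by lia.
pose j := Ordinal lp; have -> : fam m l.+1 = fupd (fam m l) j (E l + E l.+1).
  apply/ffunP => a; rewrite !ffunE ltnS -val_eqE /=.
  by case: (ltngtP a l) => // ->.
rewrite wedgeD [X in _ + X](@wedge_alternating _ _ _ _ j (Ordinal l1p)) ?addr0.
- rewrite -IH ?(ltnW lm) //; congr wedge; apply/ffunP => a; rewrite !ffunE -val_eqE /=.
  by case: (eqVneq (a : nat) l) => // ->; rewrite ltnn (ltnW lm).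
- by rewrite -val_eqE /=; lia.
- rewrite !ffunE eqxx -val_eqE /= lm; case: eqP => [|_]; first lia.
  by have -> : (l.+1 < l)%N = false by lia.
Qed.

(** The sum at place m is expanded: its summand E (m + 1) leads to [fam m m], and its summand E m to
    [fam m.+1 m], which [wedge_fam_left] reduces to [fam m.+1 0]. *)
Lemma wedge_fam m : (m <= p)%N -> wedge (fam m m) = \sum_(q < m.+1) wedge (fam q 0).
Proof.
elim: m => [|m IH] mp; first by rewrite big_ord1.
pose j := Ordinal mp; have -> : fam m.+1 m.+1 = fupd (fam m.+1 m) j (E m + E m.+1).
  apply/ffunP => a; rewrite !ffunE !ltnS -val_eqE /=.
  by case: (ltngtP a m) => // ->.
rewrite wedgeD big_ord_recr /= -IH ?(ltnW mp) // [LHS]addrC; congr (_ + _).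
  congr wedge; apply/ffunP => a; rewrite !ffunE -val_eqE /=.
  case: (ltngtP a m) => [//|am|-> //].
  by have -> : (a < m.+1)%N = false by lia.
rewrite -(@wedge_fam_left m.+1 m) //; congr wedge; apply/ffunP => a.
by rewrite !ffunE -val_eqE /=; case: (eqVneq (a : nat) m) => // ->; rewrite ltnn ltnS leqnn.
Qed.

Let bars_but (q : 'I_p.+1) : {set 'I_p.+1.*2} := @bar p.+1 @: [set~ q].

Lemma in_bars_but q x : (bar x \in bars_but q) = (x != q).
Proof. by rewrite mem_imset ?inE //; apply: bar_inj. Qed.

Lemma tilde_bars_but q x : (tilde x \in bars_but q) = false.
Proof. by apply/negP => /imsetP[y _ /esym/eqP]; rewrite bar_neq_tilde. Qed.

(** All bars form one class and each tilde is alone in its class, so a concordant set contains no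
    tilde and omits a single bar. *)
Lemma concordant_constant (A : {set 'I_p.+1.*2}) :
  (#|A| == p) && concordant_colouring (full_colouring (fun _ : 'I_p.+1 => tt)) A =
  (A \in [set bars_but q | q in [set: 'I_p.+1]]).
Proof.
set f := full_colouring _.
have Cb x : colour_class f (bar x) = @bar p.+1 @: [set: 'I_p.+1].
  apply/setP => i; rewrite inE /f /full_colouring mix_bar.
  case: (bar_tildeP i) => k; rewrite ?mix_bar ?mix_tilde ?eqxx; apply/esym.
    exact: imset_f.
  by apply/negP => /imsetP[y _ /esym/eqP]; rewrite bar_neq_tilde.
have Ct x : colour_class f (tilde x) = [set tilde x].
  apply/setP => i; rewrite !inE /f /full_colouring mix_tilde.
  case: (bar_tildeP i) => k; rewrite ?mix_bar ?mix_tilde ?bar_neq_tilde //.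
  rewrite (inj_eq (@tilde_inj _)); apply/eqP/eqP => [[]|-> //].
  (* The bars x and k tell the tildes x and k apart. *)
  move=> /dual_colouringP h; apply/val_inj; have := h x k erefl.
  by rewrite /separates /=; lia.
apply/andP/imsetP => [[_ /forallP h]|[q _ ->]].
  have tA x : tilde x \notin A.
    have := h (tilde x); rewrite Ct => /cards1P[y /setP e].
    by have := e y; rewrite !inE eqxx => /andP[yA /eqP ey]; rewrite -ey.
  have := h (bar ord0); rewrite Cb => /cards1P[y /setP e].
  have : y \in [set y] by rewrite inE.
  rewrite -e inE => /andP[yA /imsetP[q _ yq]]; exists q => //.
  apply/setP => i; case: (bar_tildeP i) => k; last first.
    by rewrite tilde_bars_but (negPf (tA k)).
  rewrite in_bars_but; have := e (bar k); rewrite !inE yq (inj_eq (@bar_inj _)).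
  by rewrite imset_f // andbT => <-; rewrite negbK.
split.
  by rewrite card_imset ?cardsC1 ?card_ord //; apply: bar_inj.
apply/forallP => i; case: (bar_tildeP i) => k.
  have -> : colour_class f (bar k) :\: bars_but q = [set bar q]; last by rewrite cards1.
  apply/setP => j; rewrite Cb !inE; case: (bar_tildeP j) => l.
    by rewrite in_bars_but imset_f // negbK andbT (inj_eq (@bar_inj _)).
  rewrite tilde_bars_but eq_sym bar_neq_tilde /=.
  by apply/negP => /imsetP[y _ /esym/eqP]; rewrite bar_neq_tilde.
have -> : colour_class f (tilde k) :\: bars_but q = [set tilde k]; last by rewrite cards1.
apply/setP => j; rewrite Ct !inE; case: eqP => [->|]; last by rewrite andbF.
by rewrite tilde_bars_but.
Qed.

Lemma constant_in_ext_lamV : in_ext_lamV (w_ R (fibres (fun _ : 'I_p.+1 => tt))).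
Proof.
have -> : w_ R (fibres (fun _ : 'I_p.+1 => tt)) = wedge (fam p p).
  rewrite w_fibres // /w_colouring (eq_bigl _ _ concordant_constant) big_imset /=.
    rewrite wedge_fam //; apply: eq_big => [q|q _]; first by rewrite inE.
    have hA : #|bars_but q| == p.
      by rewrite card_imset ?cardsC1 ?card_ord //; apply: bar_inj.
    pose K : ksub p p.+1.*2 := exist (fun A : {set _} => #|A| == p) _ hA.
    rewrite -[bars_but q]/(val K) e_set_val.
    have kE : (fun a => bar (lift q a)) =1 kelt K.
      apply: increasing_kelt => [a b ab|a]; last first.
        by rewrite in_bars_but eq_sym neq_lift.
      by rewrite /= ltn_double ltnNge leq_bump2 -ltnNge.
    rewrite /e_ -[LHS]/(wedge_delta R (kelt K)) -(eq_wedge_delta R kE).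
    congr wedge; apply/ffunP => a; rewrite !ffunE /E.
    have bE : bump q a = (if (a < q)%N then a : nat else a.+1).
      by rewrite /bump leqNgt; case: (a < q)%N.
    have -> : lift q a = inord (if (a < q)%N then a : nat else a.+1) :> 'I_p.+1.
      apply/val_inj; rewrite /= inordK ?bE // ltnS.
      by case: ifP => _; rewrite ?(ltnW (ltn_ord a)) ?ltn_ord.
    by case: ifP.
  move=> q r _ _ e; apply/eqP; rewrite -[_ == _]negbK -in_bars_but -e.
  by rewrite in_bars_but eqxx.
apply: in_ext_lamV_wedge => a; rewrite ffunE ltn_ord.
have H (g : 'I_p.+1 -> 'I_p.+1.*2) (b : bool) :
    (forall l, g l = b + l.*2 :> nat)%N -> altsum g (E a + E a.+1) = 0.
  move=> gE; rewrite linearD /= !(altsum_delta R _ gE) !odd_bar /= !doubleK.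
  rewrite !inordK ?ltnS ?(ltnW (ltn_ord a)) //.
  by rewrite -mulrDr [(-1) ^+ a.+2]exprS mulN1r subrr mulr0.
by rewrite mem_lamV (H _ true) // (H _ false) // eqxx.
Qed.

End BaseCase.

(** * A weight for the induction on partitions *)

Section Descent.
Variable n : nat.

Definition break_at (T : eqType) (c : 'I_n -> T) (k : 'I_n) :=
  (0 < k)%N && (c (ord_pred k) != c k).

(** A break at k weighs one more than a break at k + 1, so the weight drops when the former is
    traded for the latter. *)
Definition break_weight (T : eqType) (c : 'I_n -> T) : nat :=
  \sum_(k < n | break_at c k) (n - k).

Lemma break_weight_lt (T U : eqType) (c : 'I_n -> T) (d : 'I_n -> U) (k : 'I_n) :
  break_at c k -> ~~ break_at d k ->
  (forall j : 'I_n, j != k.+1 :> nat -> break_at d j -> break_at c j) ->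
  (break_weight d < break_weight c)%N.
Proof.
move=> ck dk dc; rewrite /break_weight [X in (_ < X)%N](bigD1 k) //=.
rewrite (bigID (fun j : 'I_n => j == k.+1 :> nat)) /=.
have kn := ltn_ord k.
apply: (@leq_trans ((n - k.+1).+1 + \sum_(j < n | break_at c j && (j != k)) (n - j))%N);
  last by rewrite leq_add2r; lia.
rewrite addSn ltnS; apply: leq_add.
  have [k1n|nk1] := ltnP k.+1 n; last first.
    rewrite big1 // => j /andP[_ /eqP jk]; by have := ltn_ord j; lia.
  rewrite (eq_bigl (fun j => break_at d j && (j == Ordinal k1n))) //.
  by rewrite big_mkcondl big_pred1_eq; case: ifP.
rewrite [X in (_ <= X)%N]big_mkcond [X in (X <= _)%N]big_mkcond; apply: leq_sum => j _.
case: ifP => // /andP[dj jk]; rewrite (dc j jk dj) /=.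
by case: eqVneq => // e; rewrite -e dj in dk.
Qed.

End Descent.

(** * Membership in the exterior power of V and the isolation formula *)

Section Main.
Variables (R : fieldType) (n : nat).

(* Induction on the weight of the breaks. Let k be the largest of the least
   elements of the blocks other than that of 0. If k is not a singleton, then k
   and k + 1 are in the same block, and the partition arises by isolating tilde k
   in d, where k is a singleton. In turn d arises by isolating k in the partition
   b, in which k has been moved to the block of k - 1: the break at k is lost, at
   the cost of at most a new break at k + 1. *)
Lemma nc_in_ext_lamV (T : eqType) (c : 'I_n -> T) :
  (0 < n)%N -> nc_colouring c -> in_ext_lamV (w_ R (fibres c)).
Proof.
move=> n0; have [N] := ubnP (break_weight c); elim: N => // N IH in T c *.
rewrite ltnS => wN nc.
pose ismin (k : 'I_n) := [forall x : 'I_n, (x < k)%N ==> (c x != c k)].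
have [/existsP[k0 hk0]|/existsPn nomin] := boolP [exists k : 'I_n, (0 < k)%N && ismin k];
    last first.
  (* Every positive x has an equivalent point to its left, so its block is reached from 0. *)
  have c0 (x : 'I_n) : c x = c (Ordinal n0).
    have [m] := ubnP (x : nat); elim: m x => // m IHm x; rewrite ltnS => xm.
    have [x0|x0] := posnP x; first by congr c; apply: val_inj.
    have := nomin x; rewrite x0 /= => /forallPn[y]; rewrite negb_imply negbK.
    by case/andP => yx /eqP <-; apply: IHm; apply: leq_trans xm.
  have -> : fibres c = fibres (fun _ : 'I_n => tt).
    by apply/eq_fibresP => x y; rewrite !c0 !eqxx.
  have base m : (0 < m)%N -> in_ext_lamV (w_ R (fibres (fun _ : 'I_m => tt))).
    by case: m => // p _; apply: constant_in_ext_lamV.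
  exact: base.
pose k := [arg max_(k > k0 | (0 < k)%N && ismin k) k].
have [k_gt0 /forallP kmin kmax] : [/\ (0 < k)%N, ismin k &
    forall j : 'I_n, (0 < j)%N -> ismin j -> (j <= k)%N].
  rewrite /k; case: arg_maxnP => // j /andP[j0 jm] h; split=> // l l0 lm.
  by apply: h; rewrite l0.
have {}kmin (x : 'I_n) : (x < k)%N -> c x <> c k.
  by move=> xk; apply/eqP; have := kmin x; rewrite xk.
have predk : ord_pred k = k.-1 :> nat by rewrite ord_predE; case: eqP k_gt0 => // ->.
have pk : ord_pred k != k.
  by apply/eqP => /(congr1 (@nat_of_ord n)); rewrite predk; lia.
pose d := isolate_colouring k c.
have ncd : nc_colouring d by apply: nc_isolate.
have dk x : (d x == d k) = (x == k).
  by rewrite isolate_colouringP eqxx; case: (x == k).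
pose b := merge_colouring (ord_pred k) k d.
have ncb : nc_colouring b.
  by rewrite /b -{2}[k]ord_predK; apply: nc_merge.
have bE x : x != k -> b x = Some (c x).
  by move=> xk; rewrite /b /merge_colouring dk (negPf xk) /d /isolate_colouring (negPf xk).
have bk : b (ord_pred k) = b k.
  by rewrite /b /merge_colouring !dk eqxx (negPf pk).
have Vb : in_ext_lamV (w_ R (fibres b)).
  apply: IH => //; apply: leq_trans wN; apply: (@break_weight_lt _ _ _ _ _ k).
  - by rewrite /break_at k_gt0; apply/eqP/kmin; rewrite predk; lia.
  - by rewrite /break_at bk eqxx andbF.
  move=> j jk; rewrite /break_at => /andP[j0].
  have [->|nj] := eqVneq j k; first by rewrite bk eqxx.
  have pj : ord_pred j = j.-1 :> nat by rewrite ord_predE; case: eqP j0 => // ->.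
  have npj : ord_pred j != k.
    by apply/eqP => e; move: pj; rewrite e => e'; move/eqP: jk; lia.
  by rewrite !bE // j0 => h; apply: contra h => /eqP ->.
have Vd : in_ext_lamV (w_ R (fibres d)).
  have -> : fibres d = fibres (isolate_colouring k b).
    apply/eq_fibresP => x y; rewrite !isolate_colouringP.
    case: (eqVneq x k) => [//|xk]; case: (eqVneq y k) => [//|yk] /=.
    by rewrite !bE.
  by rewrite -(bar_action R ncb bk pk); apply: in_ext_lamV_der.
have [/existsP[z /andP[/eqP cz zk]]|/existsPn single] :=
    boolP [exists z, (c z == c k) && (z != k)]; last first.
  have -> : fibres c = fibres d => //.
  apply/eq_fibresP => x y; rewrite isolate_colouringP.
  have h (u : 'I_n) : u != k -> (c u == c k) = false.
    by move=> uk; have := single u; rewrite uk andbT => /negPf.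
  case: (eqVneq x k) => [->|xk]; case: (eqVneq y k) => [->|yk] //=.
  - by rewrite eqxx.
  - by rewrite eq_sym h.
  - by rewrite h.
have kz : (k < z)%N.
  case: (ltngtP k z) => // [zk'|/val_inj e]; first by case: (kmin z).
  by rewrite e eqxx in zk.
have k1 : ordS k = k.+1 :> nat by rewrite /= modn_small // (leq_ltn_trans kz).
(* By the maximality of k, the point k + 1 is equivalent to some y at most k. If y < k and z is not
   k + 1, the pairs y, k + 1 and k, z cross. *)
have ck1 : c (ordS k) = c k.
  have : ~~ ismin (ordS k).
    by apply/negP => /kmax; rewrite k1 => /(_ isT); rewrite ltnn.
  case/forallPn => y; rewrite negb_imply negbK k1 ltnS => /andP[yk /eqP cy].
  case: (ltngtP y k) yk => // [yk|/val_inj e] _; last by rewrite -cy e.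
  have [<- //|/eqP nz] := eqVneq z (ordS k).
  have {}nz : z <> ordS k :> nat by move/val_inj.
  have := nc y (ordS k) k z cy (esym cz) (kmin y yk).
  by move: nz; rewrite /separates k1; lia.
have -> : fibres c = fibres (merge_colouring k (ordS k) d).
  have mE x : merge_colouring k (ordS k) d x = if c x == c k then None else Some (c x).
    rewrite /merge_colouring /d isolate_colouringP ck1.
    have -> : (ordS k == k) = false.
      by apply/eqP => /(congr1 (@nat_of_ord n)); rewrite k1; lia.
    rewrite /isolate_colouring eqxx.
    by case: (eqVneq x k) => [->|xk] /=; rewrite ?eqxx.
  apply/eq_fibresP => x y; rewrite !mE.
  have [ex|xk] := eqVneq (c x) (c k); have [ey|yk] := eqVneq (c y) (c k) => //.
  - by rewrite ex ey !eqxx.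
  - by rewrite ex eq_sym (negPf yk).
  - by rewrite ey (negPf xk).
(* As k is a singleton for d, no equivalent pair tells the tildes on both sides of it apart; so the
   tilde k is not a singleton and can be isolated. *)
have dd : dual_colouring d (ord_pred k) = dual_colouring d k.
  apply/dual_colouringP => x y /eqP; rewrite isolate_colouringP => /andP[/eqP xy _].
  have := separates_ord_pred x y k; rewrite xy addbb.
  by case: (separates _ _ _); case: (separates _ _ _).
by rewrite -(tilde_action R ncd dd pk); apply: in_ext_lamV_der.
Qed.

Lemma isolation_action (T : eqType) (c : 'I_n -> T) (i : 'I_n.*2) : nc_colouring c ->
  [set i] \notin full_partition (fibres c) ->
  ext_der (mulmxr (lam R i)) (w_ R (fibres c)) = w_ R (isolation i (fibres c)).
Proof.
move=> nc; rewrite full_partition_fibres // => /set1_fibres h.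
have [j [fij ji]] : exists j, full_colouring c i = full_colouring c j /\ j != i.
  have [/existsP[j /andP[/eqP e ne]]|/existsPn no] :=
    boolP [exists j, (full_colouring c i == full_colouring c j) && (j != i)].
    by exists j.
  case: h => j e; apply/eqP; have := no j.
  by rewrite e eqxx /= negbK.
move: fij ji {h}; rewrite /full_colouring.
case: (bar_tildeP i) => k; case: (bar_tildeP j) => l;
  rewrite ?mix_bar ?mix_tilde // => -[/esym e].
  rewrite (inj_eq (@bar_inj n)) isolation_bar_fibres => lk; exact: bar_action e lk.
rewrite (inj_eq (@tilde_inj n)) isolation_tilde_fibres // => lk.
exact: tilde_action e lk.
Qed.

End Main.

Theorem theorem4p26 (R : realType) (n : nat) (sigma : {set {set 'I_n}})
    (hsigma : nc_partition sigma) (i : 'I_n.*2) :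
  ([set i] \in full_partition sigma ->
     ext_der (mulmxr (lam R i)) (w_ R sigma) = 0)
  /\ ([set i] \notin full_partition sigma ->
     ext_der (mulmxr (lam R i)) (w_ R sigma) = w_ R (isolation i sigma))
  /\ ext_map vsval (wV_ R sigma) = w_ R sigma
  /\ ([set i] \in full_partition sigma ->
     ext_der (lam_res R i) (wV_ R sigma) = 0)
  /\ ([set i] \notin full_partition sigma ->
     ext_der (lam_res R i) (wV_ R sigma) = wV_ R (isolation i sigma)).
Proof.
have [sE nc] := nc_partition_pblock hsigma.
have n0 : (0 < n)%N by case: (n) i => [[]|].
have act0 : [set i] \in full_partition sigma ->
    ext_der (mulmxr (lam R i)) (w_ R sigma) = 0.
  rewrite sE full_partition_fibres // w_fibres // => /set1_fibres.
  exact: step_singleton.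
have act1 : [set i] \notin full_partition sigma ->
    ext_der (mulmxr (lam R i)) (w_ R sigma) = w_ R (isolation i sigma).
  by rewrite sE; apply: isolation_action.
have wV : ext_map vsval (wV_ R sigma) = w_ R sigma.
  have [w' e] := nc_in_ext_lamV R n0 nc; rewrite -sE in e.
  by rewrite (wV_unique e).
do !split=> //.
  (* The map induced by the inclusion of V is injective, so the identities over V follow from those
     in the ambient space. *)
  move=> hi; apply: (can_inj (ext_map_can (f := vsval) (@vsvalK _ _ (lamV R n)))).
  rewrite -ext_der_vsval wV act0 //.
  by rewrite /ext_map /ext_lift big1 // => K _; rewrite ffunE scale0r.
move=> hi; symmetry; apply: wV_unique.
by rewrite -ext_der_vsval wV; apply: act1.
Qed.
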